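(* Let $D_1\subset D_2$ be dendrites, let $f:D_1\to D_2$ be a continuous map, and let $E=\overline{D_2\setminus D_1}\cap D_1$. Suppose that $a,b\in D_1$ are such that $a$ separates $f(a)$ from $b$ (in $D_2$) and $b$ separates $f(b)$ from $a$ (in $D_2$). Then there exists a fixed point $c\in(a,b)$ of $f$ which is a cutpoint of $D_1$ (and hence of $D_2$). In particular, if there are two points $e_1\neq e_2$ in $E$ such that, for $i=1,2$, $f(e_i)$ belongs to a component of $D_2\setminus\{e_i\}$ disjoint from $D_1$, then there exists a fixed point $c\in(e_1,e_2)$ of $f$ which is a cutpoint of $D_1$ (and hence of $D_2$).
   Context: A dendrite is a locally connected (metric) continuum containing no simple closed curve. For points $a,b$ of a dendrite, $[a,b]$ is the unique arc in the dendrite joining them and $(a,b)=[a,b]\setminus\{a,b\}$. A point $x$ of a continuum $Y$ is a cutpoint of $Y$ if $Y\setminus\{x\}$ has more than one component. A point $x$ separates $y$ from $z$ in $D_2$ if $y$ and $z$ lie in distinct components of $D_2\setminus\{x\}$. *)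

(* Defs.v *)
From HB Require Import structures.
From mathcomp Require Import all_boot all_order all_algebra.
From mathcomp Require Import all_classical all_reals all_analysis.

Set Implicit Arguments.
Unset Strict Implicit.
Unset Printing Implicit Defensive.

Import Order.TTheory GRing.Theory Num.Theory.
Import numFieldNormedType.Exports.

Local Open Scope classical_set_scope.
Local Open Scope ring_scope.

(* The total map f restricts to a homeomorphism from the subspace A of U onto
   the subspace B of V; values of f outside A are irrelevant. *)
Definition homeomorphism_on (U V : topologicalType) (A : set U) (B : set V)
    (f : U -> V) : Prop :=
  set_fun A B f /\ {within A, continuous f} /\
  exists g : V -> U,
    set_fun B A g /\ {within B, continuous g} /\
    {in A, cancel f g} /\ {in B, cancel g f}.

Definition is_arc (R : realType) (T : metricType R) (a b : T) (A : set T) :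
    Prop :=
  exists h : R -> T,
    [/\ homeomorphism_on (`[0, 1] : set R) A h, h 0 = a & h 1 = b].

Definition unit_circle (R : realType) : set (R * R) :=
  [set z | z.1 ^+ 2 + z.2 ^+ 2 = 1].

Definition simple_closed_curve (R : realType) (T : metricType R) (S : set T) :
    Prop :=
  exists h : R * R -> T, homeomorphism_on (@unit_circle R) S h.

Definition continuum (R : realType) (T : metricType R) (D : set T) : Prop :=
  [/\ D !=set0, compact D & connected D].

(* Local connectedness of the subspace D: the sets D `&` W with W open in the
   ambient space are exactly the open sets of D. *)
Definition locally_connected (T : topologicalType) (D : set T) : Prop :=
  forall (x : T) (U : set T), D x -> open U -> U x ->
    exists W : set T, [/\ open W, W x, D `&` W `<=` U & connected (D `&` W)].

Definition dendrite (R : realType) (T : metricType R) (D : set T) : Prop :=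
  [/\ continuum D, locally_connected D &
      forall S : set T, S `<=` D -> ~ simple_closed_curve S].

Definition components (T : topologicalType) (A : set T) : set (set T) :=
  connected_component A @` A.

Definition cutpoint (T : topologicalType) (Y : set T) (x : T) : Prop :=
  Y x /\ exists C1 C2 : set T,
    [/\ components (Y `\ x) C1, components (Y `\ x) C2 & C1 <> C2].

Definition separates (T : topologicalType) (D : set T) (x y z : T) : Prop :=
  D x /\ exists C1 C2 : set T,
    [/\ components (D `\ x) C1, components (D `\ x) C2, C1 <> C2, C1 y & C2 z].

(* [a, b]: the arc in D joining a and b, which is unique when D is a dendrite
   and a <> b. The default value of xget yields the degenerate arc
   [a, a] = {a}, as is_arc a a is never satisfied. *)
Definition dendrite_arc (R : realType) (T : metricType R) (D : set T)
    (a b : T) : set T :=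
  xget [set a] [set A | A `<=` D /\ is_arc a b A].

Definition dendrite_open_arc (R : realType) (T : metricType R) (D : set T)
    (a b : T) : set T :=
  dendrite_arc D a b `\` [set a; b].

(* Main.v *)
(* Let A be an arc from a to b in D1, parametrized by h on [0, 1]. In a dendrite
   every interior point h t of A separates a from b, so for 0 < t < 1 the
   component L t of a in D2 \ {h t} misses b, and L s is contained in L t for
   s < t. The assumptions on a and b give f (h t) \in L t for t near 0, and
   f (h t) \notin L t for t near 1. Let c be the supremum of the s such that
   f (h t) \in L t for all t in ]0, s[. If f (h c) <> h c, then f (h t) stays in
   the component of f (h c) in D2 \ {h c} for t near c: when this component is
   L c the supremum could be increased, and otherwise f (h t) \notin L t for
   t < c close to c. Hence h c is a fixed point.

   That h t separates a from b rests on two facts: open connected subsets of a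
   locally connected compact space are arcwise connected, and two distinct arcs
   with the same endpoints contain a simple closed curve. For the former, paths
   are limits of finer and finer chains, and an arc is obtained from a path by
   collapsing a maximal open set of parameters on whose gaps the path returns to
   its starting point. *)

Require Import Defs.
From mathcomp Require Import all_boot all_order all_algebra.
From mathcomp Require Import all_classical all_reals all_analysis.
From mathcomp Require Import ring lra.
Import Order.TTheory GRing.Theory Num.Theory.
Import numFieldNormedType.Exports.

Set Implicit Arguments.
Unset Strict Implicit.
Unset Printing Implicit Defensive.

Local Open Scope classical_set_scope.
Local Open Scope ring_scope.

(** * Maps with common fibres, extreme points of closed sets, chains of open sets *)

(** Within the image of [C], the preimage under [F] of a closed [V] is the [p]-image of a compact
    set, the points of [C] that [q] sends into [V]; as [Y] is Hausdorff, it is closed. *)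
Lemma within_continuous_quotient (S Y Z : topologicalType) (C : set S)
    (p : S -> Y) (q : S -> Z) (F : Y -> Z) :
  hausdorff_space Y -> compact C ->
  {within C, continuous p} -> {within C, continuous q} ->
  (forall s, C s -> F (p s) = q s) -> {within p @` C, continuous F}.
Proof.
move=> hY cC cp cq Fpq; apply/continuous_closedP => V cV.
have /closed_subspaceP[V' cV' V'E] : closed (q @^-1` V : set (subspace C)).
  by move/continuous_closedP : cq => /(_ _ cV).
apply/closed_subspaceP; exists (p @` (C `&` V')).
  apply: (compact_closed hY); apply: continuous_compact.
    by apply: continuous_subspaceW cp => s [].
  exact: compact_closedI.
apply/seteqP; split => y [].
  move=> [s [Cs V's] <-] _; split; last by exists s.
  have : (V' `&` C) s by [].
  by rewrite V'E /preimage /from_subspace /= Fpq// => -[].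
move=> + [s Cs psy]; rewrite -psy /preimage /from_subspace /= Fpq// => Vqs.
split; last by exists s.
exists s => //; split => //.
by have : (q @^-1` V `&` C) s by []; rewrite -V'E => -[].
Qed.

(** Equality of fibres makes both induced maps well defined, and compactness makes both continuous.
    Arcs and circles are recognized in this way. *)
Lemma homeomorphism_on_fibers (S Y Z : topologicalType) (C : set S) (s0 : S)
    (p : S -> Y) (q : S -> Z) :
  hausdorff_space Y -> hausdorff_space Z -> compact C ->
  {within C, continuous p} -> {within C, continuous q} ->
  (forall s t, C s -> C t -> p s = p t <-> q s = q t) ->
  exists2 F : Y -> Z, homeomorphism_on (p @` C) (q @` C) F &
    forall s, C s -> F (p s) = q s.
Proof.
move=> hY hZ cC cp cq pq.
(* [F] and [G] evaluate at a chosen point of the fibre; the default [s0] occurs only off the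
   images. *)
pose F y := q (xget s0 [set s | C s /\ p s = y]).
pose G z := p (xget s0 [set s | C s /\ q s = z]).
have FE s : C s -> F (p s) = q s.
  move=> Cs; rewrite /F; case: xgetP => [t _ [Ct pts]|/(_ s)]; last by case.
  exact/pq.
have GE s : C s -> G (q s) = p s.
  move=> Cs; rewrite /G; case: xgetP => [t _ [Ct pts]|/(_ s)]; last by case.
  exact/pq.
exists F => //; split; first by move=> _ [s Cs <-]; exists s => //; rewrite FE.
split; first exact: within_continuous_quotient FE.
exists G; split; first by move=> _ [s Cs <-]; exists s => //; rewrite GE.
split; first exact: within_continuous_quotient GE.
by split => _ /set_mem[s Cs <-]; [rewrite FE// GE|rewrite GE// FE].
Qed.

Section real_sets.
Context {R : realType}.
Implicit Types (A : set R) (a x : R).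

Lemma closed_last A a x : closed A -> A a -> a <= x ->
  exists m, [/\ A m, a <= m, m <= x & forall s, m < s -> s <= x -> ~ A s].
Proof.
move=> cA Aa ax; pose B := A `&` [set s | s <= x].
have cB : closed B by apply: closedI => //; exact: closed_le.
have B0 : B !=set0 by exists a.
have ubB : has_ubound B by exists x => s [].
have [AB Bx] : B (sup B).
  by have := closure_sup B0 ubB; rewrite -(closure_id B).1.
exists (sup B); split => //; first by apply: ub_le_sup.
move=> s ms sx As; have : s <= sup B by apply: ub_le_sup.
by rewrite leNgt ms.
Qed.

Lemma closed_first A a x : closed A -> A a -> x <= a ->
  exists m, [/\ A m, x <= m, m <= a & forall s, x <= s -> s < m -> ~ A s].
Proof.
move=> cA Aa xa.
have cN : closed (-%R @^-1` A).
  by apply: preimage_closed => // y _; exact: opp_continuous.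
have [||m [Am am mx mA]] := @closed_last (-%R @^-1` A) (- a) (- x) cN.
- by rewrite /= opprK.
- by rewrite lerN2.
exists (- m); split => //; [lra|lra|].
move=> s xs sm As; apply: (mA (- s)); [lra|lra|].
by rewrite /= opprK.
Qed.

End real_sets.

(** Among finitely many members of a chain that cover [K], the largest already covers [K]. The
    filter [G] of final segments of the chain expresses this through near-coverings. *)
Lemma compact_chain_cover (T : topologicalType) (K : set T) (F : set (set T)) :
  F !=set0 -> compact K -> total_on F subset -> (forall X, F X -> open X) ->
  K `<=` \bigcup_(X in F) X -> exists2 X, F X & K `<=` X.
Proof.
move=> [X0 FX0] cK tF oF KF.
pose G : set_system (set T) :=
  filter_from F (fun X => [set Y | F Y /\ X `<=` Y]).
have FG : Filter G.
  apply: filter_from_filter; first by exists X0.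
  move=> X Y FX FY; have [XY|YX] := tF _ _ FX FY.
    by exists Y => // Z [FZ YZ]; split; split => //; exact: subset_trans YZ.
  by exists X => // Z [FZ YZ]; split; split => //; exact: subset_trans YZ.
have /compact_near_coveringP/(_ _ G (fun X x => X x) FG) [] := cK.
  move=> x Kx; have [X FX Xx] := KF _ Kx.
  exists (X, [set Y | F Y /\ X `<=` Y]).
    split; last by exists X.
    by apply: open_nbhs_nbhs; split => //; exact: oF.
  by move=> [y Y] [Xy [FY XY]]; exact: XY.
move=> X FX XK; exists X => //.
by apply: XK; split.
Qed.

(** * From paths to arcs *)

Section weighted_sup.
Context {R : realType}.
Implicit Types u v : nat -> R.

Let partial_sums u : set R :=
  range (fun N => \sum_(i < N) u i / 2 ^+ i.+1).

(** For nonnegative [u] the partial sums increase, so this is the sum of the series. *)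
Definition weighted_sup u : R := sup (partial_sums u).

Lemma sum_inv2X N : \sum_(i < N) (2 ^+ i.+1)^-1 <= 1 :> R.
Proof.
suff -> : \sum_(i < N) (2 ^+ i.+1)^-1 = 1 - (2 ^+ N)^-1 :> R.
  by rewrite lerBlDr lerDl invr_ge0 exprn_ge0.
elim: N => [|N IH]; first by rewrite big_ord0 expr0 invr1 subrr.
rewrite big_ord_recr/= IH exprS.
have : (2 : R) ^+ N != 0 by rewrite expf_neq0.
by move=> ?; field.
Qed.

Lemma weighted_supP u : (forall n, 0 <= u n <= 1) -> has_sup (partial_sums u).
Proof.
move=> u01; split; first by exists (\sum_(i < 0) u i / 2 ^+ i.+1); exists 0%N.
exists 1 => _ [N _ <-]; apply: le_trans (sum_inv2X N).
apply: ler_sum => i _; rewrite ler_piMl ?invr_ge0 ?exprn_ge0//.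
by case/andP: (u01 i).
Qed.

(** The weights add up to at most 1, so a uniform error [e] in the terms costs at most [e]. *)
Lemma weighted_sup_le u v e : (forall n, 0 <= u n <= 1) ->
  (forall n, 0 <= v n <= 1) -> 0 <= e -> (forall n, u n <= v n + e) ->
  weighted_sup u <= weighted_sup v + e.
Proof.
move=> u01 v01 e0 uve; have [u0 _] := weighted_supP u01.
apply: ge_sup => // _ [N _ <-].
apply: le_trans (_ : \sum_(i < N) v i / 2 ^+ i.+1 + e <= _); last first.
  by rewrite lerD2r; apply: ub_le_sup; [have [] := weighted_supP v01|exists N].
apply: le_trans (_ : \sum_(i < N) (v i + e) / 2 ^+ i.+1 <= _).
  by apply: ler_sum => i _; rewrite ler_wpM2r ?invr_ge0 ?exprn_ge0.
under eq_bigr do rewrite mulrDl.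
rewrite big_split/= lerD2l -mulr_sumr.
by rewrite ler_piMr ?sum_inv2X.
Qed.

(** The gain at index [k] is present in every partial sum that reaches [k]; hence the passage from
    [N] to [M] terms. *)
Lemma weighted_sup_lt u v k : (forall n, 0 <= u n <= 1) ->
  (forall n, 0 <= v n <= 1) -> (forall n, u n <= v n) -> u k < v k ->
  weighted_sup u < weighted_sup v.
Proof.
move=> u01 v01 uv uvk; have [u0 _] := weighted_supP u01.
pose w := (v k - u k) / 2 ^+ k.+1.
have w0 : 0 < w by rewrite divr_gt0 ?subr_gt0 ?exprn_gt0.
suff : weighted_sup u <= weighted_sup v - w.
  by move=> /le_lt_trans; apply; rewrite ltrBlDr ltrDl.
apply: ge_sup => // _ [N _ <-]; rewrite lerBrDr.
pose M := maxn N k.+1.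
have : \sum_(i < M) v i / 2 ^+ i.+1 <= weighted_sup v.
  by apply: ub_le_sup; [have [] := weighted_supP v01|exists M].
apply: le_trans.
have kM : (k < M)%N by rewrite leq_maxr.
have : \sum_(i < N) u i / 2 ^+ i.+1 <= \sum_(i < M) u i / 2 ^+ i.+1.
  rewrite -!(big_mkord xpredT (fun i => u i / 2 ^+ i.+1)).
  rewrite (@big_cat_nat _ _ _ N 0 M) ?leq_maxl//= lerDl sumr_ge0// => i _.
  by rewrite divr_ge0 ?exprn_ge0//; case/andP: (u01 i).
move=> /le_trans; rewrite -lerBrDr; apply; rewrite lerBrDr.
rewrite (bigD1 (Ordinal kM))//= [leRHS](bigD1 (Ordinal kM))//= addrAC.
apply: lerD; first by rewrite /w -mulrDl addrC subrK.
by apply: ler_sum => i _; rewrite ler_wpM2r ?invr_ge0 ?exprn_ge0.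
Qed.

End weighted_sup.

Section path_to_arc.
Context {R : realType} {T : metricType R}.
Variable g : R -> T.
Hypothesis cg : continuous g.

(* [U] is to be removed from [0, 1]; its complement is a generalized path,
   whose jumps across the gaps of [U] are harmless. *)
Let collapsible (U : set R) := [/\ open U, U `<=` `]0, 1[ &
  forall u v, ~ U u -> ~ U v -> u < v -> `]u, v[ `<=` U -> g u = g v].

(** Zorn's lemma applies: if []u, v[] is a gap of the union of a chain, a slightly smaller compact
    interval lies in one member [X]. The ends of the gap of [X] around it are close to [u] and [v]
    and have equal values under [g], so [g u] and [g v] are arbitrarily close. *)
Lemma maximal_collapse : exists U, collapsible U /\
  forall V, U `<` V -> ~ collapsible V.
Proof.
apply: Zorn_bigcup => F FP tF; split.
- by apply: bigcup_open => X /FP[].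
- by move=> x [X /FP[_ + _]]; exact.
move=> u v nu nv uv uvF; apply: mdist_positivity.
apply/eqP; rewrite eq_le mdist_ge0 andbT; apply/ler_addgt0Pl => e e0.
rewrite addr0.
have ed0 : 0 < e / 2 by rewrite divr_gt0.
have near_pt x : exists2 d, 0 < d &
    forall y, `|x - y| < d -> mdist (g x) (g y) < e / 2.
  have /metricType_numDomainType.cvgrPdist_lt/(_ _ ed0) := @cg x.
  by move=> /nbhs_ballP[d /= d0 H]; exists d => // y xy; exact: H.
have [du du0 Hu] := near_pt u; have [dv dv0 Hv] := near_pt v.
(* [m] is below both moduli of continuity, and below half the length of the gap so that
   [[u + m, v - m]] is nonempty. *)
pose m := Num.min (Num.min du dv) (v - u) / 3.
have m0 : 0 < m by rewrite divr_gt0// !lt_min du0 dv0 subr_gt0.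
have [mu mv muv] : [/\ m < du, m < dv & m + m < v - u].
  have : m * 3 = Num.min (Num.min du dv) (v - u) by rewrite /m divfK.
  have : Num.min (Num.min du dv) (v - u) <= du by rewrite !ge_min lexx.
  have : Num.min (Num.min du dv) (v - u) <= dv by rewrite !ge_min lexx orbT.
  have : Num.min (Num.min du dv) (v - u) <= v - u by rewrite !ge_min lexx orbT.
  by move=> *; split; lra.
have [X FX mX] : exists2 X, F X & `[u + m, v - m] `<=` X.
  apply: compact_chain_cover => //.
  - have [X FX _] : (\bigcup_(X in F) X) ((u + v) / 2).
      by apply: uvF; rewrite /= in_itv/=; apply/andP; split; lra.
    by exists X.
  - exact: segment_compact.
  - by move=> X /FP[].
  - move=> x /=; rewrite in_itv/= => /andP[ux xv]; apply: uvF.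
    by rewrite /= in_itv/=; apply/andP; split; lra.
have nX x : ~ (\bigcup_(X in F) X) x -> ~ X x by move=> + Xx; apply; exists X.
have [oX X01 Xg] := FP _ FX.
have cX : closed (~` X) by exact: open_closedC.
have [u' [Xu' uu' u'm u'X]]
  := @closed_last _ (~` X) u (u + m) cX (nX _ nu) ltac:(lra).
have [v' [Xv' v'm vv' v'X]]
  := @closed_first _ (~` X) v (v - m) cX (nX _ nv) ltac:(lra).
have gu'v' : g u' = g v'.
  apply: Xg => //; first lra.
  move=> x; rewrite /= in_itv/= => /andP[u'x xv'].
  have [xu|xu] := leP x (u + m); first exact: contrapT (u'X _ _ _).
  have [xv|xv] := leP (v - m) x; first exact: contrapT (v'X _ _ _).
  by apply: mX; rewrite /= in_itv/=; apply/andP; split; lra.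
apply: le_trans (metric_triangle _ (g u') _) _.
rewrite {2}gu'v' [mdist (g v') _]metric_sym [leRHS]splitr.
apply: lerD; apply: ltW.
  by apply: Hu; rewrite ltr_norml; apply/andP; split; lra.
by apply: Hv; rewrite ltr_norml; apply/andP; split; lra.
Qed.

(** [K] is what a maximal collapsible [U] leaves of [[0, 1]]. If [g u = g v] with a point of [K] in
    between, []u, v[] could be added to [U]. *)
Lemma irreducible_subpath : exists K : set R,
  [/\ closed K, K `<=` `[0, 1], K 0, K 1 &
   forall u v, K u -> K v -> u < v ->
     (g u = g v <-> forall w, u < w -> w < v -> ~ K w)].
Proof.
have [U [[oU U01 Ug] maxU]] := maximal_collapse.
have nU x : ~ (0 < x < 1) -> ~ U x.
  by move=> + Ux; apply; move/U01 : Ux; rewrite /= in_itv.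
exists (`[0, 1] `&` ~` U); split.
- by apply: closedI; [exact: interval_closed|exact: open_closedC].
- by move=> x [].
- by split; [rewrite /= in_itv/= lexx ler01|apply: nU; rewrite ltxx].
- split; first by rewrite /= in_itv/= lexx ler01.
  by apply: nU; rewrite ltxx andbF.
move=> u v [u01 nUu] [v01 nUv] uv.
move: u01 v01; rewrite /= !in_itv/= => /andP[u0 u1] /andP[v0 v1].
split=> [guv w uw wv [_]|H]; last first.
  apply: Ug => // w; rewrite /= in_itv/= => /andP[uw wv].
  apply: contrapT => nUw; apply: (H w) => //; split => //=.
  by rewrite in_itv/=; apply/andP; split; lra.
move=> nUw; apply: (maxU (U `|` `]u, v[)).
  split; first by move=> x; left.
  by move=> /(_ w) UU; apply/nUw/UU; right; rewrite /= in_itv/= uw wv.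
split.
- by apply: openU => //; exact: interval_open.
- move=> x [/U01//|]; rewrite /= !in_itv/= => /andP[ux xv].
  by apply/andP; split; lra.
(* A gap []s, t[] of the enlarged set lies on one side of []u, v[], hence in [U], or equals []u,
   v[], since [u] and [v] are outside [U]. *)
move=> s t /not_orP[nUs ns] /not_orP[nUt nt] st stU.
have inuv x : (x \in `]u, v[) <-> u < x /\ x < v.
  by rewrite in_itv/=; split => [/andP[]|[-> ->]].
have [tu|ut] := leP t u.
  apply: Ug => // x /[dup] /stU[//|/inuv[ux _]];
    rewrite /= in_itv/= => /andP[]; lra.
have [vs|sv] := leP v s.
  apply: Ug => // x /[dup] /stU[//|/inuv[_ xv]];
    rewrite /= in_itv/= => /andP[]; lra.
have su : s <= u by rewrite leNgt; apply/negP => us; apply/ns/inuv.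
have vt : v <= t by rewrite leNgt; apply/negP => tv; apply/nt/inuv.
have us : u <= s.
  rewrite leNgt; apply/negP => {}us.
  have /stU[//|/inuv[]] : u \in `]s, t[ by rewrite in_itv/= us ut.
  by rewrite ltxx.
have tv : t <= v.
  rewrite leNgt; apply/negP => {}vt.
  have /stU[//|/inuv[]] : v \in `]s, t[ by rewrite in_itv/= sv vt.
  by rewrite ltxx.
have -> : s = u by apply/eqP; rewrite eq_le su us.
by have -> : t = v by apply/eqP; rewrite eq_le tv vt.
Qed.

(* [pickle] enumerates the rationals, so the peaks [g q] of the bumps are dense
   in the image of [g]. *)
Let bump n (y : T) : R :=
  Num.max 0 (1 - mdist (g (if unpickle n is Some q then ratr q else 0)) y).

Let bump01 n y : 0 <= bump n y <= 1.
Proof.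
by rewrite /bump le_max lexx/= ge_max ler01/= gerBl mdist_ge0.
Qed.

Let bump_lip n x y : bump n x <= bump n y + mdist x y.
Proof.
rewrite /bump; set z := g _.
have := metric_triangle z x y; have := mdist_ge0 x y.
rewrite ge_max => xy0 tri; apply/andP; split.
  by rewrite addr_ge0// le_max lexx.
apply: (@le_trans _ _ (1 - mdist z y + mdist x y)); first lra.
by rewrite lerD2r le_max lexx orbT.
Qed.

(** By continuity some rational [q] near [t] has [g q] within [e] of [g t]; moving the peak by less
    than [e] changes the bump by at most [e]. *)
Lemma dense_bump (t e : R) : 0 < e -> exists n, forall y,
  1 - mdist (g t) y - e <= bump n y /\
  bump n y <= Num.max 0 (1 - mdist (g t) y + e).
Proof.
move=> e0.
have /metricType_numDomainType.cvgrPdist_lt/(_ _ e0) := @cg t.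
move=> /nbhs_ballP[d /= d0 H].
have [q qt] : exists q : rat, ratr q \in `]t, t + d[.
  by apply: rat_in_itvoo; rewrite ltrDl.
exists (pickle q) => y; rewrite /bump pickleK.
have gq : mdist (g t) (g (ratr q)) < e.
  apply: H; rewrite /ball/= ltr_norml.
  by move: qt; rewrite in_itv/= => /andP[? ?]; apply/andP; split; lra.
have t1 := metric_triangle (g t) (g (ratr q)) y.
have := metric_triangle (g (ratr q)) (g t) y.
rewrite (metric_sym (g (ratr q)) (g t)) => t2; split.
  by rewrite le_max; apply/orP; right; lra.
by rewrite ge_max le_max lexx/= le_max; apply/orP; right; lra.
Qed.

(* [phi t] is a Whitney map evaluated at the set of points visited up to time
   [t], namely a weighted sum of the running maxima of the bumps. *)
Lemma order_parameter (K : set R) : closed K -> K `<=` `[0, 1] -> K 0 ->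
  (forall u v, K u -> K v -> u < v -> g u = g v ->
     forall w, u < w -> w < v -> ~ K w) ->
  exists phi : R -> R, [/\ {within K, continuous phi},
    forall s t, K s -> K t -> s <= t -> phi s <= phi t &
    forall s t, K s -> K t -> phi s = phi t <-> g s = g t].
Proof.
move=> cK K01 K0 Kinj.
pose M t n := [set bump n (g s) | s in K `&` [set s | s <= t]].
pose m t n := sup (M t n).
pose phi t := weighted_sup (m t).
have Kge0 s : K s -> 0 <= s by move=> /K01; rewrite /= in_itv/= => /andP[].
have ubM t n : ubound (M t n) 1.
  by move=> _ [s _ <-]; case/andP: (bump01 n (g s)).
have supM t n : 0 <= t -> has_sup (M t n).
  by move=> t0; split; [exists (bump n (g 0)); exists 0|exists 1].
have m_ge s t n : K s -> s <= t -> bump n (g s) <= m t n.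
  move=> Ks st; apply: ub_le_sup; first by exists 1.
  by exists s.
have m_le t n x : K t -> (forall s, K s -> s <= t -> bump n (g s) <= x) ->
    m t n <= x.
  move=> Kt H; apply: ge_sup; first by have [] := supM t n (Kge0 _ Kt).
  by move=> _ [s [Ks st] <-]; exact: H.
have m01 t : K t -> forall n, 0 <= m t n <= 1.
  move=> Kt n; apply/andP; split.
    by apply: le_trans (m_ge t t n Kt (lexx _)); case/andP: (bump01 n (g t)).
  by apply: m_le => // s _ _; case/andP: (bump01 n (g s)).
have m_mono s t n : K s -> K t -> s <= t -> m s n <= m t n.
  move=> Ks Kt st; apply: m_le => // r Kr rs; apply: m_ge => //.
  exact: le_trans st.
have phi_mono s t : K s -> K t -> s <= t -> phi s <= phi t.
  move=> Ks Kt st; rewrite -[phi t]addr0.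
  apply: weighted_sup_le => //; [exact: m01|exact: m01|].
  by move=> n; rewrite addr0; exact: m_mono.
(* As bumps are 1-Lipschitz, points visited between [s] and [t] within [e] of [g s] raise each
   running maximum by at most [e]. *)
have phi_mod s t e : K s -> K t -> s <= t -> 0 <= e ->
    (forall r, K r -> s <= r -> r <= t -> mdist (g r) (g s) <= e) ->
    phi t <= phi s + e.
  move=> Ks Kt st e0 H; apply: weighted_sup_le => //; [exact: m01|exact: m01|].
  move=> n; apply: m_le => // r Kr rt.
  have [rs|sr] := leP r s.
    by apply: (le_trans (m_ge _ _ _ Kr rs)); rewrite lerDl.
  apply: (le_trans (bump_lip n (g r) (g s))); apply: lerD; first exact: m_ge.
  by apply: H => //; exact: ltW.
exists phi; split => //.
- apply/subspace_continuousP => x Kx; apply/cvgrPdist_le => e e0.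
  have ed0 : 0 < e / 2 by rewrite divr_gt0.
  have /metricType_numDomainType.cvgrPdist_lt/(_ _ ed0) := @cg x.
  move=> /nbhs_ballP[d /= d0 H].
  apply/nbhs_ballP; exists d => //= y xy Ky.
  have close r r' : `|x - r| < d -> `|x - r'| < d -> mdist (g r) (g r') <= e.
    move=> /H /= xr /H /= xr'; apply: le_trans (metric_triangle _ (g x) _) _.
    by rewrite metric_sym [leRHS]splitr lerD// ltW.
  have : `|x - y| < d by [].
  rewrite ltr_norml => /andP[xy1 xy2].
  have [xley|yltx] := leP x y.
    rewrite ler0_norm ?subr_le0; last exact: phi_mono.
    rewrite opprB lerBlDl; apply: phi_mod => //; first exact: ltW.
    move=> r Kr xr ry.
    by apply: close; rewrite ltr_norml; apply/andP; split; lra.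
  rewrite ger0_norm ?subr_ge0; last by apply: phi_mono => //; exact: ltW.
  rewrite lerBlDl; apply: phi_mod => //; [exact: ltW|exact: ltW|].
  by move=> r Kr xr ry; apply: close; rewrite ltr_norml; apply/andP; split; lra.
have phi_eq s t : K s -> K t -> s < t -> phi s = phi t <-> g s = g t.
  move=> Ks Kt st; split=> [|gst]; last first.
    apply/eqP; rewrite eq_le phi_mono ?(ltW st)//=.
    rewrite -[phi s]addr0; apply: phi_mod => //; first exact: ltW.
    move=> r Kr; rewrite le_eqVlt => /predU1P[<-|sr]; first by rewrite mdistxx.
    rewrite le_eqVlt => /predU1P[->|rt]; first by rewrite gst mdistxx.
    by have := Kinj _ _ Ks Kt st gst r sr rt.
  move=> phist; apply: contrapT => gst.
  (* [g c] is a point visited up to time [s] that is closest to [g t]. It differs from [g t]: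
     otherwise [c < s < t] would contradict [Kinj], or [c = s] would give [g s = g t]. *)
  have [c Jc cmin] : exists2 c, (K `&` [set r | r <= s]) c &
      forall r, K r -> r <= s -> mdist (g t) (g c) <= mdist (g t) (g r).
    have [|||c] := @compact_EVT_min R R (fun r => mdist (g t) (g r))
        (K `&` [set r | r <= s]).
    - by exists s; split => /=.
    - apply: (subclosed_compact _ (@segment_compact R 0 1)).
      + by apply: closedI => //; exact: closed_le.
      + by move=> r [/K01].
    - apply: continuous_subspaceT => r; apply/cvgrPdist_le => e e0.
      have /metricType_numDomainType.cvgrPdist_le/(_ _ e0) := @cg r.
      apply: filterS => y; rewrite ler_norml => ry.
      have := metric_triangle (g t) (g r) (g y).
      have := metric_triangle (g t) (g y) (g r).
      rewrite (metric_sym (g y) (g r)) => *; apply/andP; split; lra.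
    - rewrite inE => Jc cmin; exists c => // r Kr rs; apply: cmin.
      by rewrite inE.
  case: Jc => Kc cs.
  have ct0 : 0 < mdist (g t) (g c).
    rewrite mdist_gt0; apply/eqP => gtc.
    have ct : c < t by exact: le_lt_trans st.
    move: cs; rewrite /= le_eqVlt => /predU1P[cs|cs].
      by apply: gst; rewrite gtc cs.
    by apply: (Kinj c t Kc Kt ct _ s) => //.
  (* A bump peaking within [e] of [g t] is at least [1 - e] at [g t], but at most [1 - e * 2] at all
     points visited up to time [s]. The cap by 1 keeps the latter bound nonnegative. *)
  pose e := Num.min (mdist (g t) (g c)) 1 / 3.
  have e0 : 0 < e by rewrite divr_gt0// lt_min ct0 ltr01.
  have e3 : e * 3 = Num.min (mdist (g t) (g c)) 1 by rewrite /e divfK.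
  have e1 : e * 3 <= 1 by rewrite e3 ge_min lexx orbT.
  have ec : e * 3 <= mdist (g t) (g c) by rewrite e3 ge_min lexx.
  have [n Hn] := dense_bump t e0.
  have : phi s < phi t.
    apply: (@weighted_sup_lt _ _ _ n) => //; [exact: m01|exact: m01| |].
      by move=> k; apply: m_mono => //; exact: ltW.
    have [_ _] := Hn (g t); apply: (@lt_le_trans _ _ (1 - e)); last first.
      apply: le_trans (m_ge t t n Kt (lexx _)).
      by have [+ _] := Hn (g t); rewrite mdistxx subr0.
    apply: (@le_lt_trans _ _ (1 - e * 2)); last by lra.
    apply: m_le => // r Kr rs; have [_] := Hn (g r).
    move=> /le_trans; apply; rewrite ge_max; apply/andP; split; first lra.
    by have := cmin r Kr rs; lra.
  by rewrite phist ltxx.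
move=> s t Ks Kt; case: (ltgtP s t) => [st|ts|->//]; first exact: phi_eq.
by split=> /esym H; apply/esym/(phi_eq t s).
Qed.

(** On [K] the rescaled order parameter [psi] and the path [g] have the same fibres, and [psi] maps
    [K] onto [[0, 1]]; so the image of [K] under [g] is an arc. *)
Lemma path_arc : g 0 <> g 1 ->
  exists2 A, A `<=` g @` `[0, 1] & is_arc (g 0) (g 1) A.
Proof.
move=> g01; have [K [cK K01 K0 K1 Kg]] := irreducible_subpath.
have [phi [cphi mphi phig]] := order_parameter cK K01 K0
  (fun u v Ku Kv uv => (Kg u v Ku Kv uv).1).
have Kin s : K s -> 0 <= s <= 1 by move=> /K01; rewrite /= in_itv.
have phi01 : phi 0 < phi 1.
  rewrite lt_neqAle mphi ?ler01// andbT; apply/eqP => /phig.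
  by move=> /(_ K0 K1).
pose L := phi 1 - phi 0; have L0 : 0 < L by rewrite subr_gt0.
pose psi s := (phi s - phi 0) / L.
have cptK : compact K := subclosed_compact cK (@segment_compact _ _ _) K01.
have cpsi : {within K, continuous psi}.
  apply/subspace_continuousP => x Kx; apply: cvgM; last exact: cvg_cst.
  apply: cvgB; last exact: cvg_cst.
  by move/subspace_continuousP : cphi; exact.
have psi0 : psi 0 = 0 by rewrite /psi subrr mul0r.
have psi1 : psi 1 = 1 by rewrite /psi divff// gt_eqF.
have psi_phi s t : (psi s = psi t) <-> (phi s = phi t).
  split=> [|st]; last by rewrite /psi st.
  rewrite /psi => /(congr1 (fun x => x * L)).
  by rewrite !divfK ?gt_eqF// => /addIr.
have psi_mono s t : K s -> K t -> s <= t -> psi s <= psi t.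
  by move=> Ks Kt st; rewrite /psi ler_pM2r ?invr_gt0// lerD2r; exact: mphi.
have psiK : psi @` K = [set` `[0, 1]].
  apply/seteqP; split=> [_ [s Ks <-]|y].
    have /andP[s0 s1] := Kin _ Ks.
    by rewrite /= in_itv/= -{1}psi0 -psi1 !psi_mono.
  rewrite /= in_itv/= => /andP[y0 y1]; apply: contrapT => nypsi.
  have cK1 : closed (K `&` psi @^-1` [set x | x <= y]).
    have /continuous_closedP/(_ _ (@closed_le R y))/closed_subspaceP[V cV VE]
      := cpsi.
    by rewrite setIC -[X in closed X]VE; apply: closedI.
  have cK2 : closed (K `&` psi @^-1` [set x | x >= y]).
    have /continuous_closedP/(_ _ (@closed_ge R y))/closed_subspaceP[V cV VE]
      := cpsi.
    by rewrite setIC -[X in closed X]VE; apply: closedI.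
  (* If [psi] omitted [y], the last [u] with value at most [y] and the next [v] with value at least
     [y] would bound a gap of [K]; but [psi] agrees at the two ends of a gap. *)
  have [|//|u [[Ku uy] _ u1 umax]] := @closed_last _ _ 0 1 cK1.
    by split => //=; rewrite psi0.
  have [||v [[Kv yv] uv _ vmin]] := @closed_first _ _ 1 u cK2.
  - by split => //=; rewrite psi1.
  - exact: u1.
  have uv' : u < v.
    rewrite lt_neqAle uv andbT; apply/eqP => uvE; apply: nypsi; exists u => //.
    by apply/eqP; rewrite eq_le uy uvE.
  have : psi u = psi v.
    apply/psi_phi/phig => //; apply/Kg => // w uw wv Kw.
    have [wy|yw] := leP (psi w) y.
      apply: (umax w uw) => //; have := Kin _ Kw; lra.
    apply: (vmin w (ltW uw) wv); split => //=; exact: ltW.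
  move=> uvE; apply: nypsi; exists u => //.
  by apply/eqP; rewrite eq_le uy/= uvE.
have [h hom hE] := @homeomorphism_on_fibers R R T K 0 psi g (@Rhausdorff R)
  (@metric_hausdorff _ T) cptK cpsi (continuous_subspaceT cg)
  (fun s t Ks Kt => iff_trans (psi_phi s t) (phig s t Ks Kt)).
exists (g @` K); first exact: image_subset.
exists h; split; first by rewrite -psiK.
- by rewrite -hE// psi0.
- by rewrite -hE// psi1.
Qed.

End path_to_arc.

(** * Paths in locally connected compact sets *)

(** The points of [U] in [S] form a set both open and closed in [U]; the interiors in the proof are
    ambient open sets with the required traces. *)
Lemma connected_locally_constant (T : topologicalType) (U S : set T) :
  connected U ->
  (forall y, U y -> \forall z \near y, U z -> (S y <-> S z)) ->
  forall a b, U a -> U b -> S a -> S b.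
Proof.
move=> cU locS a b Ua Ub Sa.
suff SU : U `&` S = U by have : U b by []; rewrite -SU => -[].
have inS y : U y -> (interior (~` U `|` S)) y <-> S y.
  move=> Uy; split=> [/interior_subset[]//|Sy].
  apply: filterS (locS y Uy) => z H.
  by have [/H[+ _]|] := pselect (U z); [move=> /(_ Sy); right|left].
have inNS y : U y -> (interior (~` U `|` ~` S)) y <-> ~ S y.
  move=> Uy; split=> [/interior_subset[]//|Sy].
  apply: filterS (locS y Uy) => z H.
  by have [/H[_ SzSy]|] := pselect (U z); [right=> /SzSy|left].
apply: cU.
- by exists a.
- exists (interior (~` U `|` S)); first exact: open_interior.
  by apply/seteqP; split => y [Uy] /(inS y Uy).
- exists (~` interior (~` U `|` ~` S)); first exact/open_closedC/open_interior.
  apply/seteqP; split => y [Uy Sy]; split => //; first by move/(inNS y Uy).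
  by apply: contrapT => /(inNS y Uy).
Qed.

(** The finite sequences, directed by inclusion, form a filter for which near-covering compactness
    yields a finite subcover. *)
Lemma compact_finite_net (T : topologicalType) (K : set T) (f : T -> set T) :
  compact K -> (forall x, nbhs x (f x)) ->
  exists s : seq T, forall x, K x -> exists2 j, j \in s & f j x.
Proof.
move=> cK nf.
pose F := filter_from [set: seq T]
  (fun s => [set s' : seq T | {subset s <= s'}]).
have FF : ProperFilter F.
  apply: filter_from_proper; last by move=> s _; exists s => /=.
  apply: filter_from_filter; first by exists [::].
  move=> s s' _ _; exists (s ++ s') => // r /= sr.
  by split=> x xs; apply: sr; rewrite mem_cat xs ?orbT.
pose P (s : seq T) x := exists2 j : T, j \in s & f j x.
have /compact_near_coveringP/(_ _ F P _) H := cK.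
have /filter_ex[s sP] : \forall s \near F, K `<=` P s.
  apply: H => x Kx; exists (f x, [set s : seq T | x \in s]).
    split; first exact: nf.
    by exists [:: x] => // s /=; apply; rewrite mem_head.
  by move=> [y s] [/= fy xs]; exists x.
by exists s.
Qed.

Section local_paths.
Context {R : realType} {T : metricType R}.
Implicit Types (D C : set T) (x y : T) (e d : R).

(** A step of a chain. Unlike mere closeness, it can be refined inside its connected witness [C],
    without leaving a set of diameter [e]. *)
Definition linked D e x y := exists C : set T,
  [/\ C `<=` D, connected C, C x, C y &
    forall z w, C z -> C w -> mdist z w <= e].

Lemma near_mdist x e : 0 < e -> \forall y \near x, mdist x y < e.
Proof.
by move=> e0; apply/nbhs_ballP; exists e => //= y; rewrite ballEmdist.
Qed.

Lemma nbhs_mdistE x (U : set T) : nbhs x U ->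
  exists2 d, 0 < d & forall y, mdist x y < d -> U y.
Proof.
move=> /nbhs_ballP[d d0 dU]; exists d => // y xy.
by apply: dU; rewrite ballEmdist.
Qed.

(** A Lebesgue number argument: near [x], any two points less than [r / 2] apart lie in one small
    connected trace of an open [W]. *)
Lemma uniformly_locally_connected D e : compact D -> locally_connected D ->
  0 < e -> exists2 d, 0 < d &
    forall x y, D x -> D y -> mdist x y < d -> linked D e x y.
Proof.
move=> cD lD e0.
pose P d x := forall y, D x -> D y -> mdist x y < d -> linked D e x y.
have /compact_near_coveringP/(_ R 0^'+ P _) H := cD.
have {}H : \forall d \near 0^'+, D `<=` P d.
  apply: H => x Dx.
  have ed0 : 0 < e / 2 by rewrite divr_gt0.
  pose U := [set y | mdist x y < e / 2].
  have [|W [oW Wx WU cW]] := lD x (interior U) Dx (open_interior _).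
    exact: near_mdist.
  have [r r0 rW] := nbhs_mdistE (open_nbhs_nbhs (conj oW Wx)).
  have rd0 : 0 < r / 2 by rewrite divr_gt0.
  exists ([set y | mdist x y < r / 2], [set d | d < r / 2]).
    split; first exact: near_mdist.
    exact: nbhs_right_lt.
  move=> [x' d] [/= xx' dr] y Dx' Dy x'y.
  have Wx' : W x' by apply: rW; lra.
  have Wy : W y.
    by apply: rW; apply: (le_lt_trans (metric_triangle _ x' _)); lra.
  exists (D `&` W); split => //.
  move=> z w /WU/interior_subset zU /WU/interior_subset wU.
  apply: (le_trans (metric_triangle _ x _)).
  have {}zU : mdist x z < e / 2 by exact: zU.
  have {}wU : mdist x w < e / 2 by exact: wU.
  by rewrite (metric_sym z x); lra.
have /filter_ex[d [d0 dP]] : \forall d \near 0^'+, 0 < d /\ D `<=` P d.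
  by apply: filterI => //; exact: nbhs_right_gt.
by exists d => // x y Dx; exact: dP.
Qed.

(** Successive points of the chain lie in a common small set: those in between are picked in the
    intersections along the path, and [y] is repeated at the end. *)
Lemma path_chain (I : finType) (f : I -> set T) (C : set T) d (i : I) p x y :
  (forall j z w, f j z -> f j w -> mdist z w < d) ->
  path (fun j k => `[< exists z, [/\ C z, f j z & f k z] >]) i p ->
  C x -> C y -> f i x -> f (last i p) y ->
  exists c : nat -> T, [/\ c 0%N = x, forall k, (size p < k)%N -> c k = y,
    forall k, C (c k) & forall k, mdist (c k) (c k.+1) < d].
Proof.
move=> fd; elim: p i x => [|j p IH] i x /=.
  move=> _ Cx Cy fx fy; exists (fun k => if k is 0%N then x else y).
  split => //; [by case|by case|].
  by case=> [|k]; [exact: (fd _ _ _ fx fy)|exact: (fd _ _ _ fy fy)].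
move=> /andP[/asboolP[z [Cz iz jz]] pth] Cx Cy ix ly.
have [c [c0 cy Cc cd]] := IH j z pth Cz Cy jz ly.
exists (fun k => if k is k'.+1 then c k' else x); split => //.
- by case=> // k; rewrite ltnS; exact: cy.
- by case.
- by case=> [|k //]; rewrite c0; exact: (fd _ _ _ ix iz).
Qed.

(** [M] comes from a finite net of [D], hence serves all [C] at once. Connectedness of [C] makes the
    graph of small sets that meet within [C] connected. *)
Lemma uniform_chain D d : compact D -> 0 < d -> exists M : nat,
  forall C x y, C `<=` D -> connected C -> C x -> C y ->
  exists c : nat -> T, [/\ c 0%N = x, forall k, (M <= k)%N -> c k = y,
    forall k, C (c k) & forall k, mdist (c k) (c k.+1) < d].
Proof.
move=> cD d0; have ed0 : 0 < d / 2 by rewrite divr_gt0.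
pose f x := interior [set y | mdist x y < d / 2].
have fd j z w : f j z -> f j w -> mdist z w < d.
  move=> /interior_subset /= jz /interior_subset /= jw.
  apply: (le_lt_trans (metric_triangle _ j _)).
  by rewrite metric_sym; lra.
have [|D' Dcov] := @compact_finite_net _ D f cD.
  move=> x; apply: open_nbhs_nbhs.
  by split; [exact: open_interior|exact: near_mdist].
exists #|{: seq_sub D'}|.+1 => C x y CD cC Cx Cy.
pose e := fun j k : seq_sub D' =>
  `[< exists z, [/\ C z, f (val j) z & f (val k) z] >].
have cov z : C z -> exists j : seq_sub D', f (val j) z.
  by move=> /CD/Dcov[j jD' jz]; exists (SeqSub jD').
have [i ix] := cov x Cx.
pose S z := exists2 j : seq_sub D', connect e i j & f (val j) z.
have step j k z : connect e i j -> C z -> f (val j) z -> f (val k) z ->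
    connect e i k.
  move=> ij Cz jz kz; apply: connect_trans ij _; apply: connect1.
  by apply/asboolP; exists z.
have [j ij jy] : S y.
  apply: (connected_locally_constant cC _ Cx Cy); last by exists i.
  move=> z Cz; have [k kz] := cov z Cz.
  have : nbhs z (f (val k)).
    by apply: open_nbhs_nbhs; split => //; exact: open_interior.
  apply: filterS => w kw Cw; split=> -[j ij jz]; exists k => //.
    exact: step ij Cz jz kz.
  exact: step ij Cw jz kw.
move: jy; have /connectP[p0 pth ->] := ij.
(* A path without repetitions is no longer than the net. *)
case/shortenP : pth => p pth up _ ly.
have [c [c0 cy Cc cd]] := path_chain (fun j => @fd (val j)) pth Cx Cy ix ly.
exists c; split => // k Mk; apply: cy; apply: leq_trans Mk.
by apply: leqW; have := max_card (mem (i :: p)); rewrite (card_uniqP up).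
Qed.

(** As [M] does not depend on the link, all links of a chain can be subdivided into equally many
    parts. *)
Lemma refine_link D e' : compact D -> locally_connected D -> 0 < e' ->
  exists M : nat, forall e x y, linked D e x y ->
  exists c : nat -> T, [/\ c 0%N = x, c M.+1 = y,
    forall i, linked D e' (c i) (c i.+1) & forall i, mdist x (c i) <= e].
Proof.
move=> cD lD e0; have [d d0 dlink] := uniformly_locally_connected cD lD e0.
have [M HM] := uniform_chain cD d0.
exists M => e x y [C [CD cC Cx Cy Ce]].
have [c [c0 cy Cc cd]] := HM C x y CD cC Cx Cy.
exists c; split => //; first by apply: cy.
- by move=> i; apply: dlink => //; exact: CD.
- by move=> i; exact: Ce.
Qed.

(** Any cluster point is a limit, the distance from [u n] to later terms being bounded by the tail
    of the geometric series. *)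
Lemma compact_geometric_limit D e (u : nat -> T) : compact D -> 0 <= e ->
  (forall n, D (u n)) -> (forall n, mdist (u n) (u n.+1) <= e / 2 ^+ n) ->
  exists2 l, D l & forall n, mdist (u n) l <= e / 2 ^+ n * 2.
Proof.
move=> cD e0 Du ue.
have um n k : mdist (u n) (u (n + k)%N) <= e / 2 ^+ n * 2.
  suff : mdist (u n) (u (n + k)%N) <= e / 2 ^+ n * 2 - e / 2 ^+ (n + k) * 2.
    by move=> /le_trans; apply; rewrite gerBl mulr_ge0// divr_ge0// exprn_ge0.
  elim: k => [|k IH]; first by rewrite addn0 mdistxx subrr.
  apply: (le_trans (metric_triangle _ (u (n + k)%N) _)).
  have := ue (n + k)%N; rewrite addnS exprS invfM.
  have E : e * (2^-1 * (2 ^+ (n + k))^-1) * 2 = e / 2 ^+ (n + k).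
    by field; rewrite expf_neq0.
  by rewrite E; lra.
have [|l [Dl cl]] := cD (u @ \oo) _.
  by exists 0%N => // n _; exact: Du.
exists l => // n; apply/ler_addgt0Pr => r r0.
have := cl [set x | exists k, x = u (n + k)%N] [set y | mdist l y < r].
case.
- by exists n => // m /= nm; exists (m - n)%N; rewrite subnKC.
- exact: near_mdist.
move=> _ [[k ->]] /= lk; apply: (le_trans (metric_triangle _ (u (n + k)%N) _)).
by apply: lerD => //; rewrite metric_sym ltW.
Qed.

(** Locates a parameter consistently: its index in a refined chain, divided by the number of parts,
    is its index in the coarser chain. *)
Lemma truncn_divn (s : R) (M : nat) :
  (Num.truncn (s * M.+1%:R) %/ M.+1)%N = Num.truncn s.
Proof.
have M0 : 0 < M.+1%:R :> R by rewrite ltr0n.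
have [s0|s0] := ltP s 0.
  have tr0 (r : R) : r < 0 -> Num.truncn r = 0%N.
    by move=> r0; apply/truncn0Pn; rewrite -ltNge (lt_trans r0).
  by rewrite !tr0 ?div0n// pmulr_llt0.
have sM0 : 0 <= s * M.+1%:R by rewrite mulr_ge0// ltW.
have /andP[s1 s2] := truncn_itv s0.
apply/eqP; rewrite eqn_leq -ltnS ltn_divLR// leq_divRL//.
rewrite truncn_lt_nat// truncn_ge_nat// !natrM.
by rewrite ltr_pM2r// ler_pM2r// s1 s2.
Qed.

Lemma truncn_leS (s t : R) : s <= t -> t < s + 1 ->
  Num.truncn t = Num.truncn s \/ Num.truncn t = (Num.truncn s).+1.
Proof.
move=> st ts; have : (Num.truncn s <= Num.truncn t)%N by exact: le_truncn.
have : (Num.truncn t <= (Num.truncn s).+1)%N.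
  by rewrite truncn_le_nat (lt_trans ts)// -[ltRHS]natr1 ltrD2r truncnS_gt.
rewrite leq_eqVlt => /predU1P[|]; first by right.
by left; apply/eqP; rewrite eqn_leq -ltnS; apply/andP.
Qed.

Lemma linked_refl D e x : 0 <= e -> D x -> linked D e x x.
Proof.
move=> e0 Dx; exists [set x]; split => //; first by move=> ? ->.
  exact: connected1.
by move=> ? ? -> ->; rewrite mdistxx.
Qed.

Lemma linked_mem D e x y : linked D e x y -> [/\ D x, D y & mdist x y <= e].
Proof.
by move=> [C [CD _ Cx Cy Ce]]; split; [exact: CD|exact: CD|exact: Ce].
Qed.

Lemma geometric_small (e r : R) : 0 < e -> 0 < r -> exists n, e / 2 ^+ n < r.
Proof.
move=> e0 r0; exists (Num.truncn (e / r)).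
rewrite ltr_pdivrMr ?exprn_gt0// mulrC -ltr_pdivrMr//.
apply: lt_le_trans (truncnS_gt _) _.
by rewrite -natrX ler_nat ltn_expl.
Qed.

(* [p n] is the [n]-th chain, with [N n] steps; its [i]-th step is subdivided by
   [p n.+1] into the steps with index from [i * (M n).+1] to
   [i.+1 * (M n).+1]. *)
Lemma linked_path D e x y : compact D -> locally_connected D -> 0 < e ->
  linked D e x y -> exists g : R -> T,
    [/\ continuous g, g 0 = x, g 1 = y &
      forall t, D (g t) /\ mdist x (g t) <= e * 3].
Proof.
move=> cD lD e0 lxy.
pose eps n := e / 2 ^+ n.
have eps0 n : 0 < eps n by rewrite divr_gt0// exprn_gt0.
have [Mc Mcp] : {Mc : nat -> nat * (T -> T -> nat -> T) & forall n u v,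
    linked D (eps n) u v ->
    [/\ (Mc n).2 u v 0%N = u, (Mc n).2 u v (Mc n).1.+1 = v,
     forall i, linked D (eps n.+1) ((Mc n).2 u v i) ((Mc n).2 u v i.+1) &
     forall i, mdist u ((Mc n).2 u v i) <= eps n]}.
  apply: (@choice _ _ (fun n Mc => forall u v,
    linked D (eps n) u v ->
    [/\ Mc.2 u v 0%N = u, Mc.2 u v Mc.1.+1 = v,
     forall i, linked D (eps n.+1) (Mc.2 u v i) (Mc.2 u v i.+1) &
     forall i, mdist u (Mc.2 u v i) <= eps n])) => n.
  have [M HM] := refine_link cD lD (eps0 n.+1).
  have [c Hc] : {c : T * T -> nat -> T & forall uv,
    linked D (eps n) uv.1 uv.2 ->
    [/\ c uv 0%N = uv.1, c uv M.+1 = uv.2,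
     forall i, linked D (eps n.+1) (c uv i) (c uv i.+1) &
     forall i, mdist uv.1 (c uv i) <= eps n]}.
    apply: (@choice _ _ (fun uv c => linked D (eps n) uv.1 uv.2 ->
    [/\ c 0%N = uv.1, c M.+1 = uv.2,
     forall i, linked D (eps n.+1) (c i) (c i.+1) &
     forall i, mdist uv.1 (c i) <= eps n])) => -[u v].
    have [luv|] := pselect (linked D (eps n) u v); last by exists (fun=> u).
    by have [c Hc] := HM _ _ _ luv; exists c.
  exists (M, fun u v => c (u, v)) => u v luv; exact: (Hc (u, v)).
pose M n := (Mc n).1; pose ch n := (Mc n).2.
(* Level 0 is the chain [x, y, y, ...], so that chains are defined at all indices. *)
pose p := fix p (n q : nat) {struct n} : T := if n is n'.+1 then
    ch n' (p n' (q %/ (M n').+1)%N) (p n' (q %/ (M n').+1).+1)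
      (q %% (M n').+1)%N
  else if q is 0%N then x else y.
have [Dx Dy _] := linked_mem lxy.
have plink n q : linked D (eps n) (p n q) (p n q.+1).
  elim: n q => [|n IH] q.
    rewrite /eps expr0 divr1; case: q => [//|q] /=.
    by apply: linked_refl => //; exact: ltW.
  set m := (M n).+1.
  have [c0 cM cl _] := Mcp n _ _ (IH (q %/ m)%N).
  have -> : p n.+1 q = ch n (p n (q %/ m)%N) (p n (q %/ m).+1) (q %% m)%N by [].
  (* Either [q] and [q.+1] lie in the same block, or [q.+1] starts the next block, at the point
     where the block of [q] ends. *)
  have [qm|qm] := ltnP (q %% m).+1 m.
    have [qd qr] : (q.+1 %/ m = q %/ m /\ q.+1 %% m = (q %% m).+1)%N.
      rewrite {1 3}(divn_eq q m) -addnS divnMDl// modnMDl.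
      by rewrite (divn_small qm) addn0 (modn_small qm).
    have -> : p n.+1 q.+1 = ch n (p n (q %/ m)%N) (p n (q %/ m).+1) (q %% m).+1.
      by rewrite -qr -qd.
    exact: cl.
  have qm' : (q %% m).+1 = m.
    by apply/eqP; rewrite eqn_leq qm andbT ltn_mod.
  have [qd qr] : (q.+1 %/ m = (q %/ m).+1 /\ q.+1 %% m = 0)%N.
    rewrite {1 3}(divn_eq q m) -addnS qm' -mulSnr mulnK// modnMl//.
  have -> : p n.+1 q.+1 = p n (q %/ m).+1.
    have [<- _ _ _] := Mcp n _ _ (IH (q %/ m).+1).
    by rewrite -qd -qr.
  by have := cl (q %% m)%N; rewrite qm' cM.
have pD n q : D (p n q) by have [] := linked_mem (plink n q).
have pstep n q : mdist (p n (q %/ (M n).+1)%N) (p n.+1 q) <= eps n.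
  by have [_ _ _ +] := Mcp n _ _ (plink n (q %/ (M n).+1)%N); exact.
pose fix N n := (if n is n'.+1 then N n' * (M n').+1 else 1)%N.
have N0 n : (0 < N n)%N by elim: n => //= n IH; rewrite muln_gt0 IH.
have pmul n q : p n.+1 (q * (M n).+1)%N = p n q.
  have [<- _ _ _] := Mcp n _ _ (plink n q).
  by rewrite /= mulnK// modnMl.
have p0 n : p n 0%N = x by elim: n => // n <-; rewrite -[in RHS](pmul n 0%N).
have p1 n : p n (N n) = y.
  by elim: n => // n <-; rewrite -[in RHS](pmul n (N n)).
pose G n (t : R) := p n (Num.truncn (t * (N n)%:R)).
have Gstep n t : mdist (G n t) (G n.+1 t) <= eps n.
  have E : t * (N n.+1)%:R = t * (N n)%:R * (M n).+1%:R.
    by rewrite -mulrA -natrM.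
  by have := pstep n (Num.truncn (t * (N n.+1)%:R)); rewrite {1}E truncn_divn.
have [g Hg] : {g : R -> T & forall t,
    D (g t) /\ forall n, mdist (G n t) (g t) <= eps n * 2}.
  apply: (@choice _ _ (fun t l =>
    D l /\ forall n, mdist (G n t) l <= eps n * 2)) => t.
  have [||l Dl Hl] := @compact_geometric_limit D e (fun n => G n t) cD (ltW e0).
  - by move=> n; exact: pD.
  - by move=> n; exact: Gstep.
  - by exists l.
have limE t z : (forall n, G n t = z) -> g t = z.
  move=> Gz; apply/esym/mdist_positivity/eqP; rewrite eq_le mdist_ge0 andbT.
  apply/ler_addgt0Pr => r r0; rewrite add0r.
  have rd0 : 0 < r / 2 by rewrite divr_gt0.
  have [n nr] := geometric_small e0 rd0.
  have [_ /(_ n)] := Hg t; rewrite Gz => /le_trans; apply.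
  by rewrite -ler_pdivlMr// ltW.
exists g; split.
- move=> t; apply/metricType_numDomainType.cvgrPdist_lt => r r0.
  (* Five parts: [2 * eps n] from [g t] to [G n t], [eps n] from there to [G n s], and [2 * eps n]
     on to [g s]. *)
  have rd0 : 0 < r / 5 by rewrite divr_gt0.
  have [n nr] := geometric_small e0 rd0.
  have Nn0 : 0 < (N n)%:R :> R by rewrite ltr0n.
  have iN0 : 0 < (N n)%:R^-1 :> R by rewrite invr_gt0.
  apply/nbhs_ballP; exists (N n)%:R^-1 => //= s.
  rewrite /ball/= ltr_norml => /andP[ts1 ts2].
  have Gst : mdist (G n t) (G n s) <= eps n.
    have adj u v : u <= v -> v - u < (N n)%:R^-1 ->
        mdist (G n u) (G n v) <= eps n.
      move=> uv vu.
      have [||E|E] := @truncn_leS (u * (N n)%:R) (v * (N n)%:R).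
      - by rewrite ler_pM2r.
      - by rewrite -ltrBlDl -mulrBl -ltr_pdivlMr// div1r.
      - by rewrite /G E mdistxx ltW.
      - rewrite /G E.
        by have [] := linked_mem (plink n (Num.truncn (u * (N n)%:R))).
    have [ts|st] := leP t s; first by apply: adj => //; lra.
    by rewrite metric_sym; apply: adj; lra.
  have [_ /(_ n) Gt] := Hg t; have [_ /(_ n) Gs] := Hg s.
  apply: (le_lt_trans (metric_triangle _ (G n t) _)).
  apply: (@le_lt_trans _ _ (mdist (g t) (G n t) + (mdist (G n t) (G n s) +
    mdist (G n s) (g s)))).
    by rewrite lerD2l metric_triangle.
  rewrite metric_sym; have : eps n < r / 5 by [].
  lra.
- by apply: limE => n; rewrite /G mul0r truncn0.
- by apply: limE => n; rewrite /G mul1r natrK.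
- move=> t; have [Dgt /(_ 0%N) Gg] := Hg t; split => //.
  apply: (le_trans (metric_triangle _ (G 0%N t) _)).
  have xG : mdist x (G 0%N t) <= e.
    rewrite /G /=; case: (Num.truncn _) => [|k]; first by rewrite mdistxx ltW.
    by have [] := linked_mem lxy.
  have e_eps : eps 0%N = e by rewrite /eps expr0 divr1.
  by rewrite e_eps in Gg; lra.
Qed.

End local_paths.

Lemma continuous_glue (R : realType) (T : topologicalType)
    (g1 g2 : R -> T) (c : R) :
  continuous g1 -> continuous g2 -> g1 c = g2 c ->
  continuous (fun t => if t <= c then g1 t else g2 t).
Proof.
move=> c1 c2 g12; apply/continuous_subspace_setT.
have -> : [set: R] = [set t | t <= c] `|` [set t | c <= t].
  apply/seteqP; split => // t _.
  by case: (leP t c) => [|/ltW]; [left|right].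
apply: withinU_continuous; [exact: closed_le|exact: closed_ge| |].
- apply: (@subspace_eq_continuous _ _ _ g1); last exact: continuous_subspaceT.
  by move=> t /set_mem /= tc; rewrite /from_subspace tc.
- apply: (@subspace_eq_continuous _ _ _ g2); last exact: continuous_subspaceT.
  move=> t /set_mem /= ct; rewrite /from_subspace; case: leP => // tc.
  by have -> : t = c by apply/eqP; rewrite eq_le tc ct.
Qed.

Lemma continuous_affine (R : realType) (T : topologicalType)
    (g : R -> T) (a b : R) :
  continuous g -> continuous (fun t => g (a * t + b)).
Proof.
move=> cg t; have : {for t, continuous (g \o (fun t => a * t + b))}; last exact.
apply: continuous_comp; last exact: cg.
by apply: cvgD; [exact: mulrl_continuous|exact: cvg_cst].
Qed.

Section open_connected.
Context {R : realType} {T : metricType R}.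

(** Being joined to [a] by a path is locally constant, since nearby points are linked and links
    yield short paths. *)
Lemma open_connected_path (D W : set T) a b :
  compact D -> locally_connected D -> open W ->
  connected (D `&` W) -> (D `&` W) a -> (D `&` W) b ->
  exists g : R -> T,
    [/\ continuous g, g 0 = a, g 1 = b & forall t, (D `&` W) (g t)].
Proof.
move=> cD lD oW cDW DWa DWb.
pose joined y z := exists g : R -> T,
  [/\ continuous g, g 0 = y, g 1 = z & forall t, (D `&` W) (g t)].
have joined_trans x y z : joined x y -> joined y z -> joined x z.
  move=> [g [cg g0 g1 gD]] [h [ch h0 h1 hD]].
  exists (fun t => if t <= 1 / 2 then g (2 * t + 0) else h (2 * t + -1)); split.
  - apply: continuous_glue;
      [exact: continuous_affine|exact: continuous_affine|].
    by rewrite mulrC divfK ?pnatr_eq0// subrr addr0 g1.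
  - by rewrite divr_ge0// mulr0 addr0.
  - rewrite ifF; first by rewrite -h1; congr h; lra.
    by apply/negbTE; rewrite -ltNge; lra.
  - by move=> t; case: ifP.
have joined_sym x y : joined x y -> joined y x.
  move=> [g [cg g0 g1 gD]]; exists (fun t => g (-1 * t + 1)); split => //.
  - exact: continuous_affine.
  - by rewrite mulr0 add0r.
  - by rewrite mulN1r addNr.
have joined_refl x : (D `&` W) x -> joined x x.
  by move=> DWx; exists (fun=> x); split => // t; exact: cvg_cst.
apply: (connected_locally_constant (S := joined a) cDW _ DWa DWb);
  last exact: joined_refl.
move=> y [Dy Wy].
have [r r0 rW] := nbhs_mdistE (open_nbhs_nbhs (conj oW Wy)).
(* Paths from links of size [r / 4] stay within [3 * (r / 4) < r] of [y], hence in [W]. *)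
have r4 : 0 < r / 4 by rewrite divr_gt0.
have [d d0 dl] := uniformly_locally_connected cD lD r4.
apply: filterS (near_mdist y d0) => z yz [Dz Wz].
have jyz : joined y z.
  have [g [cg g0 g1 gD]] := linked_path cD lD r4 (dl _ _ Dy Dz yz).
  exists g; split => // t; have [Dg yg] := gD t; split => //.
  by apply: rW; lra.
by split=> [/joined_trans|/joined_trans]; apply => //; exact: joined_sym.
Qed.

Lemma open_connected_arc (D W : set T) a b : compact D -> locally_connected D ->
  open W -> connected (D `&` W) -> (D `&` W) a -> (D `&` W) b -> a <> b ->
  exists2 A, A `<=` D `&` W & is_arc a b A.
Proof.
move=> cD lD oW cDW DWa DWb ab.
have [g [cg g0 g1 gD]] := open_connected_path cD lD oW cDW DWa DWb.
have [|A Ag] := path_arc cg; first by rewrite g0 g1.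
rewrite g0 g1 => arcA; exists A => //.
by apply: subset_trans Ag _ => _ [t _ <-].
Qed.

End open_connected.

(** * Two arcs with common endpoints *)

Section circle.
Context {R : realType}.

(* [Num.sqrt] vanishes on negative numbers, so the first square root contributes
   only on [0, 1] (upper half circle) and the second one only on [1, 2]. *)
Definition circle_loop (u : R) : R * R :=
  (2 * `|u - 1| - 1,
   2 * (Num.sqrt ((1 - u) * u) - Num.sqrt ((u - 1) * (2 - u)))).

Lemma circle_loop_lower (u : R) : 0 <= u <= 1 ->
  circle_loop u = (1 - 2 * u, 2 * Num.sqrt ((1 - u) * u)).
Proof.
move=> /andP[u0 u1]; rewrite /circle_loop ler0_norm ?subr_le0//.
rewrite (@ler0_sqrtr _ ((u - 1) * (2 - u))) ?subr0; first by congr pair; lra.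
by rewrite mulr_le0_ge0 ?subr_le0 ?subr_ge0//; lra.
Qed.

Lemma circle_loop_upper (u : R) : 1 <= u <= 2 ->
  circle_loop u = (2 * u - 3, - (2 * Num.sqrt ((u - 1) * (2 - u)))).
Proof.
move=> /andP[u1 u2]; rewrite /circle_loop ger0_norm ?subr_ge0//.
rewrite (@ler0_sqrtr _ ((1 - u) * u)); first by congr pair; lra.
by rewrite mulr_le0_ge0 ?subr_le0//; lra.
Qed.

Lemma circle_loop_continuous : continuous circle_loop.
Proof.
have c1 : continuous (fun u : R => 2 * `|u - 1| - 1).
  move=> u; apply: cvgB; last exact: cvg_cst.
  apply: cvgM; first exact: cvg_cst.
  by apply: cvg_norm; apply: cvgB; [exact: cvg_id|exact: cvg_cst].
have c2 : continuous (fun u : R => Num.sqrt ((1 - u) * u)).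
  move=> u; apply: continuous_cvg; first exact: sqrt_continuous.
  by apply: cvgM; [apply: cvgB; [exact: cvg_cst|exact: cvg_id]|exact: cvg_id].
have c3 : continuous (fun u : R => Num.sqrt ((u - 1) * (2 - u))).
  move=> u; apply: continuous_cvg; first exact: sqrt_continuous.
  by apply: cvgM; apply: cvgB;
    [exact: cvg_id|exact: cvg_cst|exact: cvg_cst|exact: cvg_id].
have c4 : continuous (fun u : R =>
    2 * (Num.sqrt ((1 - u) * u) - Num.sqrt ((u - 1) * (2 - u)))).
  move=> u; apply: cvgM; first exact: cvg_cst.
  by apply: cvgB; [exact: c2|exact: c3].
by move=> u; exact: (cvg_pair (c1 u) (c4 u)).
Qed.

(** The first coordinate is injective on each half; points of different halves have second
    coordinates of opposite signs, so they agree only where both square roots vanish. *)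
Lemma circle_loop_fibers (u v : R) : 0 <= u -> u <= v -> v <= 2 ->
  circle_loop u = circle_loop v <-> (u = v \/ (u = 0 /\ v = 2)).
Proof.
move=> u0 uv v2; split=> [|[->//|[-> ->]]]; last first.
  rewrite circle_loop_lower ?lexx ?ler01// circle_loop_upper; last first.
    by apply/andP; split; lra.
  by rewrite !mulr0 !subrr !mulr0 sqrtr0; congr pair; lra.
have [u1|u1] := leP u 1; last first.
  rewrite !circle_loop_upper; [|by apply/andP; split; lra..].
  by case=> E _; left; lra.
rewrite (@circle_loop_lower u) ?u0//.
have [v1|v1] := leP v 1.
  rewrite circle_loop_lower; last by apply/andP; split; lra.
  by case=> E _; left; lra.
rewrite circle_loop_upper; last by apply/andP; split; lra.
case=> E1 E2; have vE : v = 2 - u by lra.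
have s1 := sqrtr_ge0 ((1 - u) * u).
have s2 := sqrtr_ge0 ((v - 1) * (2 - v)).
have : Num.sqrt ((1 - u) * u) = 0 by lra.
move/eqP; rewrite sqrtr_eq0 => uu.
have : (1 - u) * u = 0.
  by apply/eqP; rewrite eq_le uu mulr_ge0// subr_ge0.
by move=> /eqP; rewrite mulf_eq0 => /orP[] /eqP ?; [lra|right; lra].
Qed.

Lemma circle_loop_image : circle_loop @` `[0, 2] = @unit_circle R.
Proof.
apply/seteqP; split=> [_ [u u02 <-]|[x y]]; rewrite /unit_circle /mkset.
  have /andP[u0 u2] : 0 <= u <= 2 by move: u02; rewrite /= in_itv.
  have [u1|u1] := leP u 1.
    rewrite circle_loop_lower ?u0//= exprMn sqr_sqrtr; last first.
      by rewrite mulr_ge0// subr_ge0.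
    by ring.
  rewrite circle_loop_upper; last by rewrite u2 ltW.
  rewrite /= sqrrN exprMn sqr_sqrtr; first by ring.
  by rewrite mulr_ge0// subr_ge0// ltW.
move=> /= xy; have x2 : x ^+ 2 <= 1 by have := sqr_ge0 y; lra.
have [xm xp] : -1 <= x /\ x <= 1.
  by split; nra.
(* The parameter [(1 - x) / 2] solves [1 - 2 * z = x] on the upper half; its mirror image [2 - z]
   serves the lower half. *)
have yE (z : R) : z = ((1 - x) / 2) -> (1 - z) * z = (y / 2) ^+ 2.
  move=> ->; rewrite exprMn; have -> : y ^+ 2 = 1 - x ^+ 2 by lra.
  by field.
have [y0|y0] := leP 0 y.
  exists ((1 - x) / 2); first by rewrite /= in_itv/=; apply/andP; split; lra.
  rewrite circle_loop_lower; last by apply/andP; split; lra.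
  rewrite yE// sqrtr_sqr ger0_norm ?divr_ge0//; congr pair; lra.
exists (2 - (1 - x) / 2); first by rewrite /= in_itv/=; apply/andP; split; lra.
rewrite circle_loop_upper; last by apply/andP; split; lra.
have -> : (2 - (1 - x) / 2 - 1) * (2 - (2 - (1 - x) / 2)) =
  (1 - (1 - x) / 2) * ((1 - x) / 2) by field.
rewrite yE// sqrtr_sqr ltr0_norm; last by lra.
congr pair; lra.
Qed.

(** On [[0, 2]] the loop [q] has the same fibres as [circle_loop]. *)
Lemma loop_simple_closed_curve (T : metricType R) (q : R -> T) :
  continuous q ->
  (forall u v, 0 <= u -> u <= v -> v <= 2 ->
     q u = q v <-> (u = v \/ (u = 0 /\ v = 2))) ->
  simple_closed_curve (q @` `[0, 2]).
Proof.
move=> cq qf.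
have fib u v : `[0, 2]%classic u -> `[0, 2]%classic v ->
    circle_loop u = circle_loop v <-> q u = q v.
  rewrite /= !in_itv/= => /andP[u0 u2] /andP[v0 v2].
  have [uv|/ltW vu] := leP u v.
    by apply: iff_trans (circle_loop_fibers _ _ _) (iff_sym (qf _ _ _ _ _)).
  have := iff_trans (circle_loop_fibers v0 vu u2) (iff_sym (qf _ _ v0 vu u2)).
  by move=> [H1 H2]; split => /esym ?; apply/esym; [exact: H1|exact: H2].
have [h hom _] := @homeomorphism_on_fibers R (R * R)%type T `[0, 2] 0
  circle_loop q (@norm_hausdorff _ _) (@metric_hausdorff _ T)
  (@segment_compact R 0 2)
  (continuous_subspaceT circle_loop_continuous) (continuous_subspaceT cq) fib.
by exists h; rewrite -circle_loop_image.
Qed.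

End circle.

Section arcs.
Context {R : realType} {T : metricType R}.
Implicit Types (a b x : T) (A D : set T).

(* Precomposing with the retraction of R onto [0, 1] makes the
   parametrization continuous on the whole line. *)
Lemma is_arc_param a b A : is_arc a b A -> exists h : R -> T,
  [/\ continuous h, h 0 = a, h 1 = b, h @` `[0, 1] = A &
   (forall t, A (h t)) /\
   forall s t, 0 <= s <= 1 -> 0 <= t <= 1 -> h s = h t -> s = t].
Proof.
move=> [h [[hA [ch [k [kA [_ [hk kh]]]]]] h0 h1]].
pose r (t : R) := Num.max 0 (Num.min 1 t).
have r01 t : 0 <= r t <= 1.
  by rewrite /r le_max lexx ge_max ler01 ge_min lexx.
have rE t : 0 <= t <= 1 -> r t = t.
  by move=> /andP[t0 t1]; rewrite /r min_r// max_r.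
have cr : continuous r.
  move=> t; apply: continuous_max; first exact: cst_continuous.
  by apply: continuous_min; [exact: cst_continuous|exact: cvg_id].
exists (h \o r); split.
- move=> t; move/subspace_continuousP : ch => /(_ (r t)).
  rewrite /= in_itv/= r01 => /(_ isT) H.
  apply: cvg_comp H => P; rewrite /within/= => HP.
  have := cr t _ HP; rewrite nbhs_filterE /=; apply: filterS => s; apply.
  by rewrite in_itv /= r01.
- by rewrite /= rE ?lexx ?ler01.
- by rewrite /= rE ?lexx ?ler01.
- apply/seteqP; split=> [_ [t _ <-]|y Ay].
    by apply: hA; rewrite /= in_itv/= r01.
  have := kA y Ay; rewrite /= in_itv/= => k01.
  by exists (k y); rewrite /= ?in_itv// rE// kh// inE.
- split=> [t|s t s01 t01]; first by apply: hA; rewrite /= in_itv/= r01.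
  rewrite /= !rE// => /(congr1 k).
  by rewrite !hk// inE/= in_itv.
Qed.

(** The largest open subarc of [A] around [x] that misses [A'] has its ends on [A']; the part of
    [A'] between these ends closes it up. *)
Lemma two_arcs_circle a b A A' x : is_arc a b A -> is_arc a b A' ->
  A x -> ~ A' x -> exists2 S, S `<=` A `|` A' & simple_closed_curve S.
Proof.
move=> /is_arc_param[h [ch h0 h1 hA [Ah hinj]]].
move=> /is_arc_param[h' [ch' h'0 h'1 h'A [Ah' hinj']]].
rewrite -{1}hA => -[t0 + <-] nA't0; rewrite /= in_itv/= => /andP[t00 t01].
pose B := h @^-1` A'.
have cB : closed B.
  move/continuous_closedP : ch; apply.
  apply: (compact_closed (@metric_hausdorff _ T)); rewrite -h'A.
  apply: continuous_compact; last exact: segment_compact.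
  exact: continuous_subspaceT.
have [|s [A's s0 st0 smax]] := @closed_last _ B 0 t0 cB _ t00.
  by rewrite /B/= h0 -h'0.
have [|t [A't tt0 t1 tmin]] := @closed_first _ B 1 t0 cB _ t01.
  by rewrite /B/= h1 -h'1.
have {}st0 : s < t0.
  by rewrite lt_neqAle st0 andbT; apply: contra_notN nA't0 => /eqP <-.
have {}tt0 : t0 < t.
  by rewrite lt_neqAle tt0 andbT; apply: contra_notN nA't0 => /eqP ->.
have btw w : s < w -> w < t -> ~ A' (h w).
  move=> sw wt; have [wt0|/ltW t0w] := leP w t0; [exact: smax|exact: tmin].
have [s' s'01 hs] : exists2 s', 0 <= s' <= 1 & h' s' = h s.
  by move: A's; rewrite /B /= -h'A => -[s' + <-]; rewrite /= in_itv/= => ?;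
    exists s'.
have [t' t'01 ht] : exists2 t', 0 <= t' <= 1 & h' t' = h t.
  by move: A't; rewrite /B /= -h'A => -[t' + <-]; rewrite /= in_itv/= => ?;
    exists t'.
have s't' : t' - s' != 0.
  rewrite subr_eq0; apply/eqP => t's'.
  have : h s = h t by rewrite -hs -ht t's'.
  by move=> /hinj E; have : s = t by [apply: E; apply/andP; split; lra]; lra.
(* [q] follows [A] from [h s] to [h t], then [A'] back from [h' t'] to [h' s']. The order of [s']
   and [t'] is unknown; only [s' <> t'] matters. *)
pose q u := if u <= 1 then h ((t - s) * u + s)
            else h' ((s' - t') * u + (2 * t' - s')).
have cq : continuous q.
  apply: continuous_glue; [exact: continuous_affine|exact: continuous_affine|].
  have -> : (t - s) * 1 + s = t by ring.
  by rewrite -ht; congr h'; ring.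
exists (q @` `[0, 2]).
  move=> _ [u _ <-]; rewrite /q.
  by case: ifP => _; [left; exact: Ah|right; exact: Ah'].
apply: loop_simple_closed_curve => // u v u0 uv v2.
have q2 w : 1 <= w -> q w = h' ((s' - t') * w + (2 * t' - s')).
  move=> w1; rewrite /q; case: (leP w 1) => // w1'.
  have -> : w = 1 by apply/eqP; rewrite eq_le w1 w1'.
  have -> : (t - s) * 1 + s = t by ring.
  by rewrite -ht; congr h'; ring.
have in1 w : 0 <= w <= 1 -> 0 <= (t - s) * w + s <= 1.
  by move=> /andP[w0 w1]; apply/andP; split; nra.
have in2 w : 1 <= w <= 2 -> 0 <= (s' - t') * w + (2 * t' - s') <= 1.
  move: s'01 t'01 => /andP[? ?] /andP[? ?] /andP[w1 w2].
  by apply/andP; split; nra.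
have inj2 w w' : 1 <= w <= 2 -> 1 <= w' <= 2 -> q w = q w' -> w = w'.
  move=> w12 w12'; rewrite !q2; [|by case/andP: w12'|by case/andP: w12].
  move=> /hinj' E; have {}E := E (in2 _ w12) (in2 _ w12').
  have : (t' - s') * w = (t' - s') * w' by lra.
  by move=> /(mulfI s't').
split=> [|[->//|[-> ->]]]; last first.
  rewrite (q2 2); last by lra.
  rewrite /q ler01 mulr0 add0r -hs; congr h'; ring.
have [v1|v1] := leP v 1.
  have u1 : u <= 1 by exact: le_trans uv v1.
  rewrite /q u1 v1 => /hinj E; left.
  have {}E : (t - s) * u + s = (t - s) * v + s.
    by apply: E; apply: in1; rewrite ?u0 ?u1 ?v1 ?(le_trans u0 uv).
  have ts : t - s != 0 by rewrite subr_eq0 gt_eqF//; lra.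
  by apply: (mulfI ts); lra.
have [u1|u1] := leP 1 u.
  by move=> E; left; apply: inj2 => //; apply/andP; split; lra.
(* With [u < 1 < v], the common value is on [A'], which the first piece meets before time 1 only at
   [u = 0]; injectivity of the second piece then gives [v = 2]. *)
move=> E; right.
have A'qu : A' (h ((t - s) * u + s)).
  by move: E; rewrite {1}/q (ltW u1) => ->; rewrite q2 ?(ltW v1).
have u00 : u = 0.
  apply/eqP; rewrite eq_le u0 andbT leNgt; apply/negP => u_gt0.
  by apply: btw A'qu; nra.
split => //; apply: inj2; [by apply/andP; split; lra..|].
rewrite -E u00 (q2 2); last by lra.
rewrite /q ler01 mulr0 add0r -hs; congr h'; ring.
Qed.

End arcs.

(** * Cut points of dendrites *)

Section cut_components.
Context {R : realType} {T : metricType R}.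
Implicit Types (D C : set T) (x y z : T).

Lemma near_component D O x : locally_connected D -> open O -> (D `&` O) x ->
  \forall y \near x, D y -> connected_component (D `&` O) x y.
Proof.
move=> lD oO [Dx Ox]; have [W [oW Wx WO cW]] := lD x O Dx oO Ox.
apply: filterS (open_nbhs_nbhs (conj oW Wx)) => y Wy Dy.
by exists (D `&` W) => //; split => // z DWz; split; [case: DWz|exact: WO].
Qed.

Lemma setD1_openE D x : exists2 O, open O & D `\ x = D `&` O.
Proof.
exists (~` [set x]); last by rewrite setDE.
apply/closed_openC/accessible_closed_set1/hausdorff_accessible.
exact: metric_hausdorff.
Qed.

Lemma near_componentD1 D x y z : locally_connected D ->
  connected_component (D `\ x) y z ->
  \forall w \near z, D w -> connected_component (D `\ x) y w.
Proof.
move=> lD; have [V oV ->] := setD1_openE D x; move=> yz.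
have Vz := connected_component_sub yz.
by apply: filterS (near_component lD oV Vz) => w H /H;
  exact: connected_component_trans.
Qed.

Lemma componentD1_open D x y : locally_connected D -> exists2 W, open W &
  connected_component (D `\ x) y = D `&` W.
Proof.
move=> lD; pose C := connected_component (D `\ x) y.
exists (interior (~` D `|` C)); first exact: open_interior.
apply/seteqP; split=> z; last by move=> [Dz /interior_subset[]].
move=> Cz; split; first by have [] := connected_component_sub Cz.
apply: filterS (near_componentD1 lD Cz) => w H.
by have [/H|] := pselect (D w); [right|left].
Qed.

(** Otherwise the component of [a], being open in [D] and connected, contains an arc from [a] to [b]
    avoiding [x], and the two arcs produce a simple closed curve in [D]. *)
Lemma dendrite_arc_cut D a b A x : dendrite D -> is_arc a b A -> A `<=` D ->
  A x -> x <> a -> x <> b -> ~ connected_component (D `\ x) a b.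
Proof.
move=> [[_ cptD _] lD noS] arcA AD Ax xa xb ab.
have [W oW CE] := componentD1_open x a lD.
have Da : (D `\ x) a.
  exact: connected_component_sub (connected_component_sym ab).
have aneb : a <> b.
  have [h [_ h0 h1 _ [_ hinj]]] := is_arc_param arcA.
  rewrite -h0 -h1 => /hinj; rewrite !lexx ler01 => /(_ isT isT)/eqP.
  by rewrite eq_sym oner_eq0.
have [||||A' A'C arcA'] := @open_connected_arc _ _ D W a b cptD lD oW.
- by rewrite -CE; exact: component_connected.
- by rewrite -CE; exact: connected_component_refl.
- by rewrite -CE.
- by [].
have nA'x : ~ A' x.
  by move=> /A'C; rewrite -CE => /connected_component_sub[_]; apply.
have [S SA cS] := two_arcs_circle arcA arcA' Ax nA'x.
by apply: noS cS => y /SA[/AD|/A'C[]].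
Qed.

(** A nonempty relatively clopen [B] meets [C], by openness if it contains [x]; hence it contains
    [C], and then [x] by closedness. *)
Lemma connected_setU1 C x :
  connected C -> closure C x -> connected (C `|` [set x]).
Proof.
move=> cC Cx B B0 [V oV BV] [F cF BF].
have [[z [Cz Bz]]|/set0P/negP/negPn/eqP CB0] := pselect (C `&` B !=set0).
  have CB : C `&` B = C.
    apply: cC; first by exists z.
    - by exists V => //; rewrite BV setIA (setIidl (@subsetUl _ _ _)).
    - by exists F => //; rewrite BF setIA (setIidl (@subsetUl _ _ _)).
  have CF : C `<=` F by move=> y; rewrite -CB BF => -[_ []].
  apply/seteqP; split; first by rewrite BV; exact: subIsetl.
  move=> y [|->]; first by rewrite -{1}CB => -[].
  rewrite BF; split; first by right.
  by apply: cF; exact: closureS CF _ Cx.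
have [z Bz] := B0.
have [Cz|zx] : (C `|` [set x]) z by move: Bz; rewrite BV => -[].
  by have : (C `&` B) z by []; rewrite CB0.
have Vx : V x by move: Bz; rewrite BV zx => -[].
have [y [Cy Vy]] := Cx V (open_nbhs_nbhs (conj oV Vx)).
have : (C `&` B) y by split => //; rewrite BV; split => //; left.
by rewrite CB0.
Qed.

(** If [x] were not adherent to the component, the latter would be open and closed in the connected
    [D], hence would contain [x]. *)
Lemma componentD1_closure D x z : connected D -> locally_connected D ->
  D x -> (D `\ x) z -> closure (connected_component (D `\ x) z) x.
Proof.
move=> cD lD Dx Dz; apply: contrapT => nCx.
pose C := connected_component (D `\ x) z.
have : C x.
  apply: (connected_locally_constant (S := C) cD _ (proj1 Dz) Dx);
    last exact: connected_component_refl.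
  move=> y Dy; have [->|yx] := pselect (y = x).
    have oc : nbhs x (~` closure C).
      by apply: open_nbhs_nbhs; split => //; exact/closed_openC/closed_closure.
    apply: filterS oc => w nCw _.
    split=> [/connected_component_sub[_ /(_ erefl)]//|Cw].
    by case: nCw; exact: subset_closure.
  have Dxy : (D `\ x) y by [].
  apply: filterS (near_componentD1 lD (connected_component_refl Dxy)) =>
    w yw /yw {}yw.
  split=> [zy|zw]; first exact: connected_component_trans zy yw.
  exact: connected_component_trans zw (connected_component_sym yw).
by move=> /connected_component_sub[_]; apply.
Qed.

End cut_components.

(** * Coincidence of a map [F] with an arc [h] of cut points *)

Section fixed_point.
Context {R : realType} {T : metricType R}.
Variables (D : set T) (h F : R -> T).
Hypothesis cD : connected D.
Hypothesis lD : locally_connected D.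
Hypothesis ch : continuous h.
Hypothesis cF : continuous F.
Hypothesis hD : forall t, D (h t).
Hypothesis FD : forall t, D (F t).
Hypothesis hinj : forall s t, 0 <= s <= 1 -> 0 <= t <= 1 -> h s = h t -> s = t.
Hypothesis cut : forall t, 0 < t < 1 ->
  ~ connected_component (D `\ h t) (h 0) (h 1).

Let K t y z := connected_component (D `\ h t) y z.

Let segment_K t r s : 0 <= r -> r <= s -> s <= 1 -> 0 <= t <= 1 ->
  (t < r) || (s < t) -> K t (h r) (h s).
Proof.
move=> r0 rs s1 t01 trs.
exists (h @` `[r, s]); last by exists s => //; rewrite /= in_itv/= rs lexx.
split; first by exists r => //; rewrite /= in_itv/= lexx rs.
  move=> _ [u + <-]; rewrite /= in_itv/= => /andP[ru us]; split => // /hinj E.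
  have : u = t by apply: E => //; apply/andP; split; lra.
  by move: trs => /orP[]; lra.
apply: connected_continuous_connected; first exact: segment_connected.
exact: continuous_subspaceT.
Qed.

(** A connected set from [h 0] to [z] off [h s] that met [h t] would, with the subarc from [h t] to
    [h 1], connect [h 0] to [h 1] off [h s]. *)
Let K_increase s t z : 0 < s -> s < t -> t < 1 ->
  K s (h 0) z -> K t (h 0) z.
Proof.
move=> s0 st t1 [C [C0 CD cC] Cz].
exists C => //; split => // y Cy; split; first by have [] := CD y Cy.
move=> yht; apply: (@cut s); first lra.
apply: (@connected_component_trans _ _ (h t)).
  by exists C => //; rewrite -yht.
by apply: segment_K; lra.
Qed.

(** For small [t], [F t] stays in the component of [F 0] off [h 0]. Adding [h 0] keeps this set
    connected, and it misses [h t], which is connected to [h 1] off [h 0]. *)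
Lemma component_near_start : (D `\ h 0) (F 0) ->
  ~ connected_component (D `\ h 0) (F 0) (h 1) ->
  exists2 e, 0 < e <= 1 & forall t, 0 < t -> t < e ->
    connected_component (D `\ h t) (h 0) (F t).
Proof.
move=> DF0 nF0h1.
have F00 := connected_component_refl DF0.
have := cF (near_componentD1 lD F00); rewrite /fmap /=.
move=> /nbhs_ballP[e /= e0 eF].
exists (Num.min e 1); first by rewrite lt_min e0 ltr01 ge_min lexx orbT.
move=> t t0; rewrite lt_min => /andP[te t1].
pose C := connected_component (D `\ h 0) (F 0).
have CFt : C (F t) by apply: eF (FD t); rewrite /ball/= sub0r normrN gtr0_norm.
exists (C `|` [set h 0]); last by left.
split; first by right.
  move=> y [Cy|->].
    split; first by have [] := connected_component_sub Cy.
    move=> yht; apply: nF0h1; apply: (@connected_component_trans _ _ (h t)).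
      by rewrite -yht.
    by apply: segment_K; lra.
  split; first exact: hD.
  by move=> /hinj E; have : 0 = t by [apply: E; lra]; lra.
apply: connected_setU1; first exact: component_connected.
exact: componentD1_closure.
Qed.

Lemma cut_fixed_point (e1 e2 : R) : 0 < e1 <= 1 -> 0 <= e2 < 1 ->
  (forall t, 0 < t -> t < e1 -> K t (h 0) (F t)) ->
  (forall t, e2 < t -> t < 1 -> ~ K t (h 0) (F t)) ->
  exists2 c, 0 < c < 1 & F c = h c.
Proof.
move=> /andP[e10 e11] /andP[e20 e21] H1 H2.
pose Z := [set s | s <= 1 /\ forall t, 0 < t -> t < s -> K t (h 0) (F t)].
have Ze1 : Z e1 by [].
have ubZ : has_ubound Z by exists 1 => s [].
pose c := sup Z.
have c0 : 0 < c by apply: (lt_le_trans e10); exact: ub_le_sup.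
have c1 : c < 1.
  (* A member of [Z] beyond [m] would contradict [H2] at [m]. *)
  pose m := (e2 + 1) / 2.
  have [m0 m1] : e2 < m /\ m < 1 by rewrite /m; split; lra.
  apply: (le_lt_trans _ m1); apply: ge_sup; first by exists e1.
  move=> s [_ Zs]; rewrite leNgt; apply/negP => ms.
  by apply: (H2 m) => //; apply: Zs => //; lra.
have Kc t : 0 < t -> t < c -> K t (h 0) (F t).
  move=> t0 tc; have [s [s1 Zs] ts] : exists2 s, Z s & t < s.
    by apply: sup_gt => //; exists e1.
  exact: Zs.
exists c; first by rewrite c0 c1.
apply: contrapT => Fchc.
have [KcF|nKcF] := pselect (K c (h 0) (F c)).
  have := cF (near_componentD1 lD KcF); rewrite /fmap /=.
  move=> /nbhs_ballP[d /= d0 dF].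
  pose s := Num.min (c + d) 1.
  have cs : c < s by rewrite lt_min ltrDl d0 c1.
  have Zs : Z s.
    split; first by rewrite ge_min lexx orbT.
    move=> t t0; rewrite lt_min => /andP[tcd t1].
    have [tc|ct|->//] := ltgtP t c; first exact: Kc.
    apply: (K_increase c0 ct t1); apply: dF (FD t).
    by rewrite /ball/= ltr_norml; apply/andP; split; lra.
  have : s <= c by exact: ub_le_sup.
  by rewrite leNgt cs.
have DFc : (D `\ h c) (F c) by split => //; exact: FD.
have := cF (near_componentD1 lD (connected_component_refl DFc));
  rewrite /fmap /=.
move=> /nbhs_ballP[d /= d0 dF].
(* This [t] is positive, less than [c] and within [d] of [c]. *)
pose t := Num.max (c / 2) (c - d / 2).
have tc : t < c by rewrite gt_max; apply/andP; split; lra.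
have t0 : 0 < t by rewrite lt_max; apply/orP; left; lra.
have ct : `|c - t| < d.
  have : c - d / 2 <= t by rewrite le_max lexx orbT.
  by move=> ?; rewrite ltr_norml; apply/andP; split; lra.
apply: nKcF.
apply: connected_component_trans (K_increase t0 tc c1 (Kc t t0 tc)) _.
by apply: connected_component_sym; apply: dF (FD t).
Qed.

End fixed_point.

(** * Separation in dendrites and the fixed cutpoint *)

Section dendrites.
Context {R : realType} {T : metricType R}.
Implicit Types (D : set T) (a b x y z : T).

Lemma componentsP (A : set T) (C : set T) y : components A C -> C y ->
  A y /\ C = connected_component A y.
Proof.
move=> [x Ax <-] Cy; split; first exact: connected_component_sub Cy.
exact: same_connected_component.
Qed.

Lemma separatesP D x y z : separates D x y z <->
  [/\ D x, (D `\ x) y, (D `\ x) z & ~ connected_component (D `\ x) y z].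
Proof.
split=> [[Dx [C1 [C2 [c1 c2 C12 C1y C2z]]]]|[Dx Dy Dz nyz]].
  have [Dy E1] := componentsP c1 C1y; have [Dz E2] := componentsP c2 C2z.
  split => // yz; apply: C12; rewrite E1 E2; exact: same_connected_component.
split => //; exists (connected_component (D `\ x) y),
  (connected_component (D `\ x) z).
split; [by exists y|by exists z| |exact: connected_component_refl..].
by move=> E; apply: nyz; rewrite E; exact: connected_component_refl.
Qed.

Lemma separates_cutpoint D x y z : separates D x y z -> cutpoint D x.
Proof.
by move=> [Dx [C1 [C2 [c1 c2 C12 _ _]]]]; split => //; exists C1, C2.
Qed.

Lemma dendrite_arc_exists D a b : dendrite D -> D a -> D b -> a <> b ->
  dendrite_arc D a b `<=` D /\ is_arc a b (dendrite_arc D a b).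
Proof.
move=> [[_ cptD cD] lD _] Da Db ab.
have [||||A AD arcA] := @open_connected_arc _ _ D setT a b cptD lD openT.
- by rewrite setIT.
- by [].
- by [].
- by [].
rewrite /dendrite_arc; apply: (@xgetPex _ _ [set A | A `<=` D /\ is_arc a b A]).
by exists A; split => // x /AD[].
Qed.

Lemma dendrite_cut_separates D a b A x :
  dendrite D -> is_arc a b A -> A `<=` D ->
  A x -> x <> a -> x <> b -> D a -> D b -> separates D x a b.
Proof.
move=> dD arcA AD Ax xa xb Da Db; apply/separatesP; split.
- exact: AD.
- by split => // /esym.
- by split => // /esym.
- exact: (dendrite_arc_cut dD arcA AD Ax xa xb).
Qed.

Lemma dendrite_fixed_cutpoint D1 D2 (f : T -> T) a b :
  dendrite D1 -> dendrite D2 -> D1 `<=` D2 -> set_fun D1 D2 f ->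
  {within D1, continuous f} -> D1 a -> D1 b ->
  separates D2 a (f a) b -> separates D2 b (f b) a ->
  exists c : T, [/\ dendrite_open_arc D1 a b c, f c = c,
                    cutpoint D1 c & cutpoint D2 c].
Proof.
move=> dD1 dD2 D12 fD cf D1a D1b.
move=> /separatesP[D2a fa2 ba nab] /separatesP[D2b fb2 ab nba].
have aneb : a <> b by case: ab.
have [AD1 arcA] := dendrite_arc_exists dD1 D1a D1b aneb.
have AD2 := subset_trans AD1 D12.
have [h [ch h0 h1 hA [Ah hinj]]] := is_arc_param arcA.
(* All values of [h] lie in the arc, hence in [D1], so continuity of [f] within [D1] suffices on the
   whole line. *)
have cF : continuous (f \o h).
  move=> t; move/subspace_continuousP : cf => /(_ (h t) (AD1 _ (Ah t))) H.
  apply: cvg_comp H => P; rewrite /within/= => HP.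
  have := ch t _ HP; rewrite nbhs_filterE /=; apply: filterS => s; apply.
  exact: AD1.
have hne t : 0 < t < 1 -> h t <> a /\ h t <> b.
  move=> t01; split; [rewrite -h0|rewrite -h1] => /hinj E.
    by have : t = 0 by [apply: E; lra]; lra.
  by have : t = 1 by [apply: E; lra]; lra.
have cut t : 0 < t < 1 -> ~ connected_component (D2 `\ h t) (h 0) (h 1).
  move=> /hne[hta htb]; rewrite h0 h1.
  exact: (dendrite_arc_cut dD2 arcA AD2).
have [[_ _ cD2] lD2 _] := dD2.
have hD t : D2 (h t) by exact: AD2.
have FD t : D2 ((f \o h) t) by apply: fD; exact: AD1.
have [||e1 e1P H1]
  := @component_near_start _ _ D2 h (f \o h) cD2 lD2 ch cF hD FD hinj.
- by rewrite /= h0.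
- by rewrite /= h0 h1.
(* The arc run backwards, to treat the end [b] like the end [a]. *)
pose rh t := h (-1 * t + 1).
have [|||||||e2 e2P H2] := @component_near_start _ _ D2 rh (f \o rh) cD2 lD2.
- exact: continuous_affine.
- exact: (@continuous_affine _ _ (f \o h) (-1) 1 cF).
- by move=> t; exact: hD.
- by move=> t; exact: FD.
- move=> s t s01 t01 /hinj E.
  suff : -1 * s + 1 = -1 * t + 1 by lra.
  by apply: E; lra.
- by rewrite /rh /= mulr0 add0r h1.
- by rewrite /rh /= mulr0 add0r h1 mulr1 addNr h0.
have [||c c01 fc] := @cut_fixed_point _ _ D2 h (f \o h) lD2 ch cF hD FD hinj cut
    e1 (1 - e2) e1P _ H1.
- by lra.
(* Near [b], [f (h t)] is in the component of [h 1] off [h t]; were it also in that of [h 0], [h t]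
   would not separate the ends. *)
- move=> t te t1 K0; apply: (cut t); first by lra.
  apply: connected_component_trans K0 _; apply: connected_component_sym.
  have := H2 (1 - t); rewrite /rh /= mulr0 add0r.
  have -> : -1 * (1 - t) + 1 = t by ring.
  by apply; lra.
exists (h c); have [hca hcb] := hne c c01.
split => //.
- by split => //; case.
- apply: separates_cutpoint.
  exact: (dendrite_cut_separates dD1 arcA AD1 (Ah c) hca hcb D1a D1b).
- apply: separates_cutpoint.
  exact: (dendrite_cut_separates dD2 arcA AD2 (Ah c) hca hcb D2a D2b).
Qed.

End dendrites.

Theorem proposition3p1 (R : realType) (T : metricType R) (D1 D2 : set T)
    (f : T -> T) (hD1 : dendrite D1) (hD2 : dendrite D2) (hD12 : D1 `<=` D2)
    (hfun : set_fun D1 D2 f) (hcont : {within D1, continuous f}) :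
  let E := closure (D2 `\` D1) `&` D1 in
  (forall a b : T, D1 a -> D1 b ->
     separates D2 a (f a) b -> separates D2 b (f b) a ->
     exists c : T, [/\ dendrite_open_arc D1 a b c, f c = c,
                       cutpoint D1 c & cutpoint D2 c]) /\
  (forall e1 e2 : T, E e1 -> E e2 -> e1 <> e2 ->
     (exists C : set T,
        [/\ components (D2 `\ e1) C, C (f e1) & C `&` D1 = set0]) ->
     (exists C : set T,
        [/\ components (D2 `\ e2) C, C (f e2) & C `&` D1 = set0]) ->
     exists c : T, [/\ dendrite_open_arc D1 e1 e2 c, f c = c,
                       cutpoint D1 c & cutpoint D2 c]).
Proof.
move=> E; split=> [a b|e1 e2 [_ D1e1] [_ D1e2] e12 C1P C2P].
  exact: dendrite_fixed_cutpoint.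
(* The component of [f e] off [e] misses [D1], hence does not contain [e']. *)
have sep e e' : D1 e -> D1 e' -> e <> e' ->
    (exists C, [/\ components (D2 `\ e) C, C (f e) & C `&` D1 = set0]) ->
    separates D2 e (f e) e'.
  move=> D1e D1e' ee' [C [cC Cfe CD1]].
  have [D2fe CE] := componentsP cC Cfe.
  apply/separatesP; split => //.
  - exact: hD12.
  - by split; [exact: hD12|move=> /esym].
  by rewrite -CE => Ce'; have : (C `&` D1) e' by []; rewrite CD1.
apply: dendrite_fixed_cutpoint => //; apply: sep => //.
by move=> /esym.
Qed.
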